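(* Assume any prior $\pi(d\theta)$ for $\theta$. Then the posterior distribution of $\theta$ given $N$ i.i.d. observations $\mathbf{T}=(T_1,\dots,T_N)$ from $f(\cdot|G,\theta)$ (model in the context) is characterized by $$\Pr(\theta\in B|\mathbf{T})=\int_B\sum_{\mathbf{S}^+}\sum_{\mathbf{S}^-}\pi(\mathbf{S}^-,\mathbf{S}^+,d\theta|\mathbf{T})$$ for any Borel set $B\subset\mathbb{R}$, where $$\pi(\mathbf{S}^-,\mathbf{S}^+,d\theta|\mathbf{T})=\frac{\phi^+_\theta(\mathbf{S}^+,\mathbf{T})\,\phi^-_\theta(\mathbf{S}^-,\mathbf{S}^+,\mathbf{T})\,\pi(d\theta)}{\int_{\mathbb{R}}\sum_{\mathbf{S}^+}\sum_{\mathbf{S}^-}\phi^+_\vartheta(\mathbf{S}^+,\mathbf{T})\,\phi^-_\vartheta(\mathbf{S}^-,\mathbf{S}^+,\mathbf{T})\,\pi(d\vartheta)},$$ with $$\phi^+_\theta(\mathbf{S}^+,\mathbf{T})=|\mathbb{C}_{\mathbf{S}^+}|\,\chi(\mathcal{M}_{1,n}(\mathbf{S}^+))\prod_{1\le j\le n:\,S_j^+>S_{j-1}^+}\int_{Y_j}^{\infty}U^{-(S_j^+-S_{j-1}^+)}H(dU)$$ and $$\phi^-_\theta(\mathbf{S}^-,\mathbf{S}^+,\mathbf{T})=|\mathbb{C}_{\mathbf{S}^-}|\,\frac{\chi(\mathcal{M}_{1,n}(\mathbf{S}^+),\mathcal{M}_{1,N-n}(\mathbf{S}^-))}{\chi(\mathcal{M}_{1,n}(\mathbf{S}^+))}\prod_{1\le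 j\le N-n:\,S_j^->S_{j-1}^-}\int_{-\infty}^{Z_j}(-V)^{-(S_j^--S_{j-1}^-)}H(dV).$$ For each $\theta$ the sums run over all $\mathbf{S}$-paths $\mathbf{S}^+$ of $n+1$ coordinates and $\mathbf{S}^-$ of $N-n+1$ coordinates, $n$ being the number of $k$ with $T_k>\theta$.
   Context: Species sampling model. $G$ is a random probability measure on $\mathbb{R}$ of the form $G(\cdot)=\sum_k W_k\delta_{\xi_k}(\cdot)+(1-\sum_kW_k)H(\cdot)$, where $H$ is a non-atomic probability measure on $\mathbb{R}$, the $\xi_k$ are i.i.d. $H$, and the random weights $0<W_k<1$, $\sum_kW_k\le1$, are independent of the $\xi_k$. If $X_1,\dots,X_N$ are i.i.d. from $G$ given $G$, with partition $\mathbf{p}=\{C_1,\dots,C_{N(\mathbf{p})}\}$ of $\{1,\dots,N\}$ into the classes of equal values, $C_k=\{j:X_j=X_k^*\}$, $X_k^*$ the unique values, $e_k=|C_k|$, then the joint law of $(X_1,\dots,X_N)$ is $\pi(\mathbf{p})\prod_{k=1}^{N(\mathbf{p})}H(dX_k^* )$ with $\pi(\mathbf{p})=\chi(e_1,\dots,e_{N(\mathbf{p})})$. Here $\chi$ is a symmetric function of finite lists of positive integers (the exchangeable partition probability function of $G$, defined for every sample size); $\chi$ of the empty list is $1$. Model. $\theta$ is a real random variable with prior probability distribution $\pi(d\theta)$, independent of $G$. Given $G$ and $\theta$, the $T_k$ are i.i.d. with density $f(t|G,\theta)=\int X^{-1}[\mathbb{I}(0<t-\theta\le X)-\mathbb{I}(X\le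 t-\theta<0)]\,G(dX)$, $t\in\mathbb{R}$. $\mathbb{I}$ is the indicator. Ordering. For each $\theta$, the values $T_1-\theta,\dots,T_N-\theta$ are (almost surely) distinct and nonzero and are listed as $\mathbf{Z}=(Z_{N-n},\dots,Z_1)$, $Z_{N-n}<\dots<Z_1<0$, and $\mathbf{Y}=(Y_1,\dots,Y_n)$, $0<Y_1<\dots<Y_n$; so $n$, $\mathbf{Y}$, $\mathbf{Z}$ depend on $\theta$ and $\mathbf{T}$. (For $\theta\in\{T_1,\dots,T_N\}$ the likelihood is zero and the integrand is taken to be $0$.) $\mathbf{S}$-paths. An $\mathbf{S}$-path of $n+1$ coordinates is an integer vector $\mathbf{S}=(S_0,\dots,S_n)$ with $S_0=0$, $S_n=n$, $S_j\le j$ and $S_j\le S_{j+1}$ for $j=1,\dots,n-1$. A partition of $\{1,\dots,n\}$ corresponds to $\mathbf{S}$ if the maximal elements of its cells are exactly the $j$ with $S_j>S_{j-1}$ and the cell with maximal element $j$ has size $S_j-S_{j-1}$. $\mathbb{C}_{\mathbf{S}}$ is the set of partitions corresponding to $\mathbf{S}$; $|\mathbb{C}_{\mathbf{S}}|=\prod_{j:S_j>S_{j-1}}\binom{j-1-S_{j-1}}{j-S_j}$. $\mathcal{M}_{a,b}(\mathbf{S})$ is the list (multiset) $\{S_j-S_{j-1}:S_j>S_{j-1},\ a\le j\le b\}$; $\chi(\mathcal{M},\mathcal{M}')$ is $\chi$ evaluated at the concatenated list. The posterior is the version given by Bayes' formula, for $\mathbf{T}$ of positive finite marginal density; the product $\phi^+_\theta\phi^-_\theta$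 is read as $0$ when some factor (including a denominator) vanishes. *)

(* Defs.v *)
From HB Require Import structures.
From mathcomp Require Import all_boot all_order all_algebra.
From mathcomp Require Import all_classical all_reals all_analysis.
From mathcomp Require Import measurable_realfun.

Set Implicit Arguments.
Unset Strict Implicit.
Unset Printing Implicit Defensive.

Import Order.TTheory GRing.Theory Num.Theory.
Import numFieldNormedType.Exports.

Local Open Scope classical_set_scope.
Local Open Scope ring_scope.

Section Independence.
Context d (Omega : measurableType d) (R : realType) (P : probability Omega R).

Definition sigma_of d' (E : measurableType d') (J : Type) (D : set J)
    (X : J -> Omega -> E) : set (set Omega) :=
  <<s \bigcup_(j in D) preimage_set_system setT (X j) measurable >>.

Definition independent_systems (F1 F2 : set (set Omega)) : Prop :=
  forall A B, F1 A -> F2 B -> P (A `&` B) = (P A * P B)%E.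

Definition iid_law (I : choiceType) (X : I -> Omega -> R)
    (H : probability R R) : Prop :=
  forall (s : seq I) (A : I -> set R),
    uniq s -> (forall i, measurable (A i)) ->
    P (\big[setI/setT]_(i <- s) (X i @^-1` A i)) = (\prod_(i <- s) H (A i))%E.

End Independence.

Section SpeciesSampling.
Context d (Omega : measurableType d) (R : realType) (P : probability Omega R).

(* A random probability measure is a probability kernel from [Omega]. The
   countable index type [I] covers finitely as well as infinitely many atoms. *)
Record species_sampling (I : countType) (H : probability R R)
    (W xi : I -> {RV P >-> R}) (G : R.-pker Omega ~> R) : Prop := {
  ss_nonatomic : forall x : R, H [set x] = 0%E ;
  ss_iid : iid_law P (fun k => xi k : Omega -> R) H ;
  ss_indep : independent_systems P
    (sigma_of setT (fun k => W k : Omega -> R))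
    (sigma_of setT (fun k => xi k : Omega -> R)) ;
  ss_weight_bounds : {ae P, forall w, forall k, 0 < W k w < 1} ;
  ss_weight_sum : {ae P, forall w, (\esum_(k in setT) (W k w)%:E <= 1)%E} ;
  ss_form : {ae P, forall w, forall A : set R, measurable A ->
    G w A = (\esum_(k in setT) ((W k w)%:E * \d_(xi k w) A)
             + (1 - \esum_(k in setT) (W k w)%:E) * H A)%E} }.

Definition block_sizes (M : nat) (p : {set {set 'I_M}}) : seq nat :=
  [seq #|(C : {set 'I_M})| | C <- enum p].

(* The joint law of a sample X_1, ..., X_M that is i.i.d. from [G] given [G]
   assigns E[prod_i G(A_i)] to the rectangle A_1 x ... x A_M, and the measure
   chi(e_1, ..., e_{N(p)}) prod_k H(dX_k^* ) carried by the partition [p] assigns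
   to it chi(e) prod_{C in p} H(bigcap_{i in C} A_i); a law on R^M is determined
   by its values on rectangles. *)
Record is_eppf (H : probability R R) (G : R.-pker Omega ~> R)
    (chi : seq nat -> R) : Prop := {
  eppf_nil : chi [::] = 1 ;
  eppf_sym : forall s1 s2 : seq nat,
    all (leq 1) s1 -> perm_eq s1 s2 -> chi s1 = chi s2 ;
  eppf_joint_law : forall (M : nat) (A : 'I_M -> set R),
    (forall i, measurable (A i)) ->
    (\int[P]_w \prod_(i < M) G w (A i) =
     \sum_(p : {set {set 'I_M}} | finset.partition p [set: 'I_M]%SET)
       (chi (block_sizes p))%:E *
       \prod_(C in p) H (\bigcap_(i in [set i | i \in C]) A i))%E }.

Definition independent_of_G (theta : {RV P >-> R}) (G : R.-pker Omega ~> R) :=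
  independent_systems P
    (sigma_of setT (fun _ : unit => theta : Omega -> R))
    (sigma_of (E := \bar R) measurable (fun (A : set R) (w : Omega) => G w A)).

Definition mix_kernel (u x : R) : R :=
  x^-1 * ((0 < u <= x)%R%:R - (x <= u < 0)%R%:R).

Definition density (g : {measure set R -> \bar R}) (th t : R) : \bar R :=
  (\int[g]_x (mix_kernel (t - th) x)%:E)%E.

Definition likelihood (G : R.-pker Omega ~> R) (theta : {RV P >-> R})
    (T : seq R) (w : Omega) : \bar R :=
  (\prod_(t <- T) density (G w) (theta w) t)%E.

Definition marginal_density (G : R.-pker Omega ~> R) (theta : {RV P >-> R})
    (T : seq R) : \bar R :=
  (\int[P]_w likelihood G theta T w)%E.

(* Bayes' formula for Pr(theta in B | T), with [G] integrated out. *)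
Definition posterior (G : R.-pker Omega ~> R) (theta : {RV P >-> R})
    (T : seq R) (B : set R) : \bar R :=
  ((\int[P]_(w in theta @^-1` B) likelihood G theta T w)
   / marginal_density G theta T)%E.

End SpeciesSampling.

Section SPaths.
Variable n : nat.

(* Every S-path is nondecreasing from S_0 = 0 with S_j <= j, hence
   0 <= S_j <= n, so functions into {0, ..., n} suffice. *)
Definition svec := {ffun 'I_n.+1 -> 'I_n.+1}.

Definition scoord (S : svec) (j : nat) : nat := S (inord j).

Definition is_spath (S : svec) : bool :=
  [&& scoord S 0 == 0, scoord S n == n,
      all (fun j => scoord S j <= j)%N (index_iota 1 n) &
      all (fun j => scoord S j <= scoord S j.+1)%N (index_iota 1 n)].

(* M_{a,b}(S) *)
Definition increments (a b : nat) (S : svec) : seq nat :=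
  [seq (scoord S j - scoord S j.-1)%N
     | j <- index_iota a b.+1 & (scoord S j.-1 < scoord S j)%N].

Definition is_cell_max (C : {set 'I_n}) (i : 'I_n) : bool :=
  (i \in C) && [forall k in C, (k <= i)%N].

(* The element j of {1, ..., n} is encoded as the ordinal of value j - 1. *)
Definition corresponds (S : svec) (p : {set {set 'I_n}}) : bool :=
  [&& finset.partition p [set: 'I_n]%SET,
      [forall i : 'I_n,
         [exists C in p, is_cell_max C i] == (scoord S i < scoord S i.+1)%N] &
      [forall C in p, forall i : 'I_n,
         is_cell_max C i ==> (#|C| == scoord S i.+1 - scoord S i)%N]].

Definition card_CS (S : svec) : nat :=
  #|[set p : {set {set 'I_n}} | corresponds S p]%SET|.

End SPaths.

Section Formula.
Context (R : realType) (H : probability R R) (chi : seq nat -> R).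

Definition n_above (th : R) (T : seq R) : nat := count (fun t => th < t) T.

(* Y_j and Z_j, for j >= 1 *)
Definition Yseq (th : R) (T : seq R) (j : nat) : R :=
  nth 0 (sort <=%R [seq t - th | t <- T & th < t]) j.-1.

Definition Zseq (th : R) (T : seq R) (j : nat) : R :=
  nth 0 (sort >=%R [seq t - th | t <- T & t < th]) j.-1.

(* [H] is non-atomic, so including the endpoints Y_j and Z_j is immaterial; it
   matches the weak inequalities of [mix_kernel]. *)
Definition phi_plus (th : R) (T : seq R) (n : nat) (Sp : svec n) : R :=
  (card_CS Sp)%:R * chi (increments 1 n Sp) *
  \prod_(1 <= j < n.+1 | (scoord Sp j.-1 < scoord Sp j)%N)
    \int[H]_(u in `[Yseq th T j, +oo[) u ^- (scoord Sp j - scoord Sp j.-1).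

Definition phi_minus (th : R) (T : seq R) (n m : nat)
    (Sm : svec m) (Sp : svec n) : R :=
  (card_CS Sm)%:R *
  (chi (increments 1 n Sp ++ increments 1 m Sm) / chi (increments 1 n Sp)) *
  \prod_(1 <= j < m.+1 | (scoord Sm j.-1 < scoord Sm j)%N)
    \int[H]_(v in `]-oo, Zseq th T j]) (- v) ^- (scoord Sm j - scoord Sm j.-1).

(* phi^+ phi^-; since x / 0 = 0, the product vanishes as soon as some
   factor or denominator does. *)
Definition phi_prod (th : R) (T : seq R) (n m : nat)
    (Sm : svec m) (Sp : svec n) : R :=
  if th \in T then 0 else phi_plus th T Sp * phi_minus th T Sm Sp.

Definition normalizer (prior : probability R R) (N : nat) (T : N.-tuple R) :
    \bar R :=
  (\int[prior]_th
     (\sum_(Sp : svec (n_above th T) | is_spath Sp)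
      \sum_(Sm : svec (N - n_above th T) | is_spath Sm)
        phi_prod th T Sm Sp)%R%:E)%E.

(* The density of pi(S^-, S^+, dtheta | T) with respect to [prior]. *)
Definition post_term (prior : probability R R) (N : nat) (T : N.-tuple R)
    (th : R) (n m : nat) (Sm : svec m) (Sp : svec n) : \bar R :=
  ((phi_prod th T Sm Sp)%:E / normalizer prior T)%E.

End Formula.

(* Main.v *)
Require Import Defs.
From HB Require Import structures.
From mathcomp Require Import all_boot all_order all_algebra.
From mathcomp Require Import all_classical all_reals all_analysis.
From mathcomp Require Import measurable_realfun.
From mathcomp Require Import ring lra zify.

(** The proof rests on three ideas.

    Bayes' formula.  Independence of [theta] and [G] allows the integral of the
    likelihood over the event [theta \in B] to be computed in two stages: first
    average over [G] with [theta] held at a value [th], then integrate over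
    [th \in B] against the prior ([integral_likelihood]).  Everything is thus
    reduced to the identification, for each fixed [th], of the averaged
    likelihood with the double sum of the products phi^+ phi^-
    ([expected_likelihood_phi]); the posterior and the normalising constant
    then agree termwise.

    From partitions to S-paths.  For fixed [th] the likelihood is a product of
    integrals of the functions k_i = [mix_kernel (T_i - th)] against [G].  The
    joint law of a sample from [G], which is given on rectangles, extends to
    products of nonnegative functions ([eppf_functions]):
      E prod_i int k_i dG = sum_p chi(sizes of p) prod_(C in p) int prod_(i in C) k_i dH,
    where p runs over all set partitions of the observations.  An observation
    above [th] contributes x^-1 I(u <= x) with u > 0, one below [th]
    contributes (-x)^-1 I(x <= u) with u < 0.  Two facts follow.  A block that
    contains observations from both sides contributes 0, so p splits into a
    partition of the observations above [th] and one of those below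
    ([sum_partitions_disjoint_sum]).  The integral of a block on one side
    depends only on its cardinality and on its observation farthest from [th]
    ([integral_block_pos], [integral_block_neg]).  Once the observations on each
    side are sorted by distance to [th], the farthest observation is the maximal
    index of the block, and maximal elements together with block sizes are
    exactly what an S-path records; grouping the partitions by their S-path
    produces the multiplicities |C_S| ([sum_partitions_spaths],
    [expected_likelihood_spaths]).

    The quotient in phi^-.  The factor chi(M^+, M^-) / chi(M^+) multiplied by
    the factor chi(M^+) of phi^+ gives chi(M^+, M^-) only if chi(M^+, M^-) = 0
    whenever chi(M^+) = 0 ([eppf_cat_eq0]); nonnegativity of chi ([eppf_ge0])
    is needed as well, already for the extension from rectangles to functions.
    Both are read off from the joint law on small cubes.  If B_1, ..., B_r are
    disjoint and each has H-measure eps, then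
      E prod_j G(B_j)^(e_j) = chi(e_1, ..., e_r) eps^r + O(eps^(r+1))
    ([eppf_expansion]), because only partitions finer than the one into the
    prescribed cells contribute and each additional block costs a factor eps.
    Sets of this kind exist for every eps = 1/m since [H] has no atoms
    ([nonatomic_split]). *)

Set Implicit Arguments.
Unset Strict Implicit.
Unset Printing Implicit Defensive.

Import Order.TTheory GRing.Theory Num.Theory.
Import numFieldNormedType.Exports.

Local Open Scope classical_set_scope.
Local Open Scope ring_scope.

(** * Splitting a non-atomic law on the line into pieces of equal mass *)

Section NonatomicSplitting.
Context (R : realType) (H : probability R R).
Hypothesis H_nonatomic : forall x : R, H [set x] = 0%E.

Let idRV : R -> R := idfun.
HB.instance Definition _ :=
  @isMeasurableFun.Build _ _ _ _ idRV (@measurable_id _ _ setT).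

Let ray (x : R) : set R := `]-oo, x].

Let cdfE x : cdf (idRV : {RV H >-> R}) x = H (ray x).
Proof. by []. Qed.

Let ray_le x y : x <= y -> (H (ray x) <= H (ray y))%E.
Proof. by move=> xy; rewrite -!cdfE; exact: cdf_nondecreasing. Qed.

(** The supremum of the points where the distribution function is at most [a]
    works: right continuity gives one inequality at that point, and the absence
    of an atom gives left continuity and hence the other. *)
Lemma nonatomic_cdf_onto (a : R) : 0 < a < 1 ->
  exists x : R, H `]-oo, x]%classic = a%:E.
Proof.
move=> /andP[a0 a1]; pose S := [set x | (H (ray x) <= a%:E)%E].
have [x0 Sx0] : exists x, S x.
  apply: contrapT => /forallNP h.
  have := cvg_cdfNy0 (idRV : {RV H >-> R}).
  move/cvge_to_ge => /(_ a%:E); rewrite lee_fin leNgt a0 /=.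
  move=> /(_ _)/negP; apply => //; apply: nearW => x /=; rewrite cdfE.
  by case: (leP (H (ray x)) a%:E) => [/(h x)|/ltW].
have [x1 hx1] : exists x, (a%:E < H (ray x))%E.
  apply: contrapT => /forallNP h.
  have := cvg_cdfy1 (idRV : {RV H >-> R}).
  move/cvge_to_le => /(_ a%:E); rewrite lee_fin leNgt a1 /=.
  move=> /(_ _)/negP; apply => //; apply: nearW => x /=; rewrite cdfE.
  by rewrite leNgt; apply/negP => /h.
have Sub : ubound S x1.
  move=> y Sy; rewrite leNgt; apply/negP => /ltW/ray_le.
  by rewrite leNgt (le_lt_trans Sy).
have hS : has_sup S by split; [exists x0|exists x1].
pose s := sup S; exists s; apply/eqP; rewrite eq_le; apply/andP; split.
- have -> : `]-oo, s]%classic = `]-oo, s[%classic `|` [set s] :> set R.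
    by rewrite setUitv1.
  rewrite measureU //=; last first.
    by apply/seteqP; split => // x [] /= + xs; rewrite in_itv /= xs ltxx.
  rewrite H_nonatomic adde0.
  have -> : `]-oo, s[%classic =
      \bigcup_k `]-oo, (s - k.+1%:R^-1)%R]%classic :> set R.
    apply/seteqP; split => x /=; rewrite ?in_itv /=.
      move=> /ltr_add_invr[k xk]; exists k => //=.
      by rewrite in_itv /= lerBrDr ltW.
    by move=> [k _] /=; rewrite in_itv /= => /le_lt_trans; apply; rewrite ltrBlDr ltrDl.
  have hc : H `]-oo, (s - k.+1%:R^-1)%R]%classic @[k --> \oo] -->
      H (\bigcup_k `]-oo, (s - k.+1%:R^-1)%R]%classic).
    apply: nondecreasing_cvg_mu => //; first exact: bigcup_measurable.
    move=> n m nm; apply/subsetPset; apply: subset_itvl.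
    by rewrite bnd_simp lerD2l lerN2 lef_pV2 ?posrE// ler_nat.
  apply: (cvge_to_le hc); apply: nearW => n /=.
  have n0 : 0 < n.+1%:R^-1 :> R by rewrite invr_gt0.
  have [y Sy ly] := sup_adherent n0 hS.
  exact: (le_trans (ray_le (ltW ly))).
- rewrite -[leRHS]cdfE.
  apply: (cvge_to_ge (@cdf_right_continuous _ _ _ _ (idRV : {RV H >-> R}) s)).
   near=> y; rewrite cdfE leNgt; apply/negP => /ltW Sy.
  have : y <= s by apply: ub_le_sup => //; exists x1.
  by apply/negP; rewrite -ltNge; near: y; exact: nbhs_right_gt.
Unshelve. all: by end_near. Qed.

(** The pieces are differences of successive half-lines on which the
    distribution function reaches j/m. *)
Lemma nonatomic_split (m : nat) : (0 < m)%N ->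
  exists B : nat -> set R, [/\ forall j, measurable (B j), trivIset setT B &
    forall j, (j < m)%N -> H (B j) = (m%:R^-1)%:E].
Proof.
move=> m0.
(* Being downward closed makes the sets [D j] comparable for inclusion; their
   order is then forced by their masses. *)
have /choice[D hD] (j : nat) : exists D : set R, [/\ measurable D,
    forall x y, D y -> x <= y -> D x &
    ((j <= m)%N -> H D = (j%:R / m%:R)%:E)].
  case: (posnP j) => [->|j0].
    by exists set0; split => //; rewrite mul0r measure0.
  case: (ltngtP j m) => jm; last first.
  - exists setT; split => // _.
    by rewrite probability_setT jm divff // pnatr_eq0 -lt0n.
  - by exists set0; split.
  - have [|x hx] := @nonatomic_cdf_onto (j%:R / m%:R).
      rewrite divr_gt0 ?ltr0n//= ltr_pdivrMr ?ltr0n// mul1r ltr_nat //.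
    exists `]-oo, x]%classic; split=> // u v /=.
    by rewrite !in_itv /= => vx uv; exact: le_trans vx.
have Dmono i j : (i <= j <= m)%N -> D i `<=` D j.
  move=> /andP[]; rewrite leq_eqVlt => /orP[/eqP-> _ x //|ij jm x Dix].
  have [mi di hi] := hD i; have [mj dj hj] := hD j.
  apply: contrapT => nDjx.
  suff : (H (D j) <= H (D i))%E.
    have im : (i <= m)%N by rewrite (leq_trans (ltnW ij)).
    rewrite (hi im) (hj jm) lee_fin ler_pM2r ?invr_gt0 ?ltr0n// ler_nat.
    by rewrite leqNgt ij.
  apply: le_measure; rewrite ?inE // => y Djy; apply: (di y x Dix).
  rewrite leNgt; apply/negP => /ltW; exact/(contra_not _ nDjx)/dj.
exists (fun j => if (j < m)%N then D j.+1 `\` D j else set0); split.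
- move=> j; case: ifP => // _.
  by apply: measurableD; [have [] := hD j.+1|have [] := hD j].
- have dis i j : (i < j)%N -> (j < m)%N ->
      (D i.+1 `\` D i) `&` (D j.+1 `\` D j) = set0.
    move=> ij jm; apply/seteqP; split => // x [[Dix _] [_ []]].
    by apply: Dmono Dix; rewrite ij ltnW.
  apply/trivIsetP => i j _ _; wlog ij : i j / (i < j)%N.
    move=> h; rewrite neq_ltn => /orP[] ij; first by apply: h => //; rewrite neq_ltn ij.
    by rewrite setIC; apply: h => //; rewrite neq_ltn ij.
  move=> _; case: ifP => // im; last by rewrite set0I.
  by case: ifP => // jm; [exact: dis|rewrite setI0].
- move=> j jm; rewrite jm measureD; last 3 first.
  + by have [] := hD j.+1.
  + by have [] := hD j.
  + by rewrite (le_lt_trans (probability_le1 _ _)) ?ltry//; have [] := hD j.+1.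
  rewrite setIidr; last by apply: Dmono; rewrite leqnSn.
  have [_ _ /(_ jm) h1] := hD j.+1; have [_ _ /(_ (ltnW jm)) h0] := hD j.
  transitivity ((j.+1%:R / m%:R)%:E - (j%:R / m%:R)%:E : \bar R)%E.
    exact: (congr2 (fun u v : \bar R => u - v)%E h1 h0).
  by rewrite -EFinB -mulrBl -natrB ?leqnSn// subSnn mul1r.
Qed.

End NonatomicSplitting.

(** * Set partitions and their transport along maps *)

Section Partitions.

Definition cell_sizes (J : finType) (p : {set {set J}}) : seq nat :=
  [seq #|C : {set J}| | C <- enum p].

Definition push_partition (J K : finType) (h : J -> K) (p : {set {set J}}) :
  {set {set K}} := [set h @: (C : {set J}) | C in p]%SET.

Lemma push_partitionK (J K : finType) (h : J -> K) (g : K -> J) :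
  cancel h g -> cancel (push_partition h) (push_partition g).
Proof.
move=> hK p; rewrite /push_partition -imset_comp -[RHS]imset_id.
apply: eq_imset => C /=; rewrite -imset_comp -[RHS]imset_id.
exact: eq_imset.
Qed.

Lemma partition_push (J K : finType) (h : J -> K) (p : {set {set J}}) :
  bijective h ->
  finset.partition (push_partition h p) [set: K]%SET =
  finset.partition p [set: J]%SET.
Proof.
move=> hb; rewrite -(imset_partition _ _ (bij_inj hb)); congr finset.partition.
apply/esym/setP => y; rewrite inE; apply/imsetP.
by case: hb => g _ gK; exists (g y); rewrite ?inE ?gK.
Qed.

Lemma perm_cell_sizes_push (J K : finType) (h : J -> K) (p : {set {set J}}) :
  injective h -> perm_eq (cell_sizes (push_partition h p)) (cell_sizes p).
Proof.
move=> h_inj; rewrite /cell_sizes.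
have -> : [seq #|C : {set J}| | C <- enum p] =
    [seq #|C : {set K}| | C <- [seq h @: (C : {set J}) | C <- enum p]].
  by rewrite -map_comp; apply: eq_map => C /=; rewrite card_imset.
apply: perm_map; apply: uniq_perm; rewrite ?enum_uniq //.
  rewrite map_inj_uniq ?enum_uniq //; exact: imset_inj.
move=> C; rewrite mem_enum; apply/imsetP/mapP => -[D Dp ->]; exists D => //.
  by rewrite mem_enum.
by rewrite mem_enum in Dp.
Qed.

Lemma big_push_partition (S : Type) (idx : S) (op : Monoid.com_law idx)
    (J K : finType) (h : J -> K) (p : {set {set J}}) (F : {set K} -> S) :
  injective h ->
  \big[op/idx]_(C in push_partition h p) F C =
  \big[op/idx]_(C in p) F (h @: C)%SET.
Proof. by move=> h_inj; rewrite big_imset // => C D _ _; apply: imset_inj. Qed.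

Lemma cell_sizes_gt0 (J : finType) (p : {set {set J}}) :
  finset.partition p [set: J]%SET -> all (leq 1) (cell_sizes p).
Proof.
move=> /and3P[_ _ p0]; rewrite all_map; apply/allP => C /=.
rewrite mem_enum => Cp; rewrite card_gt0; apply: contraNneq p0 => <-.
by [].
Qed.

End Partitions.

(** * The partition probability function on rectangles *)

Section ErealProducts.
Context d (X : measurableType d) (R : realType).
Local Open Scope ereal_scope.

Lemma emeasurable_prod (D : set X) (I : Type) (s : seq I) (Q : pred I)
    (f : I -> X -> \bar R) :
  (forall i, Q i -> measurable_fun D (f i)) ->
  measurable_fun D (fun x => \prod_(i <- s | Q i) f i x).
Proof.
move=> mf; elim: s => [|i s ih].
  by apply: (eq_measurable_fun (cst 1)) => // x _; rewrite big_nil.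
rewrite (_ : (fun _ => _) = fun x => if Q i
    then f i x * \prod_(j <- s | Q j) f j x else \prod_(j <- s | Q j) f j x);
  last by apply/funext => x; rewrite big_cons.
case: (boolP (Q i)) => // Qi.
by apply: emeasurable_funM => //; exact: mf.
Qed.

Lemma prode_le1 (I : Type) (s : seq I) (Q : pred I) (f : I -> \bar R) :
  (forall i, Q i -> 0 <= f i <= 1) -> 0 <= \prod_(i <- s | Q i) f i <= 1.
Proof.
move=> f01; elim/big_ind : _ => //; first by rewrite lexx lee01.
move=> x y /andP[x0 x1] /andP[y0 y1]; rewrite mule_ge0//=.
by rewrite -[1]mule1; exact: lee_pmul.
Qed.

End ErealProducts.

Section EPPF.
Context d (Omega : measurableType d) (R : realType) (P : probability Omega R).
Context (H : probability R R) (G : R.-pker Omega ~> R) (chi : seq nat -> R).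
Hypothesis hchi : is_eppf P H G chi.
Local Open Scope ereal_scope.

(** The sample may be indexed by any finite type: chi is symmetric, so the choice
    of an enumeration does not matter. *)
Lemma eppf_rectangle (J : finType) (A : J -> set R) :
  (forall j, measurable (A j)) ->
  \int[P]_w \prod_(j : J) G w (A j) =
  \sum_(p : {set {set J}} | finset.partition p [set: J]%SET)
    (chi (cell_sizes p))%:E *
    \prod_(C in p) H (\bigcap_(j in [set j | j \in C]) A j).
Proof.
move=> mA; pose f : 'I_#|J| -> J := enum_val.
have fb : bijective f by exists enum_rank => x; rewrite /f ?enum_valK ?enum_rankK.
have [_ hsym hlaw] := hchi.
transitivity (\int[P]_w \prod_(i < #|J|) G w (A (f i))).
  by apply: eq_integral => w _; rewrite (reindex f) //; exact: onW_bij.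
rewrite hlaw //.
rewrite [RHS](reindex (push_partition f)) /=; last first.
  have [g fK gK] := fb.
  by exists (push_partition g) => q _; rewrite push_partitionK.
apply: eq_big => [p|p pp]; first by rewrite partition_push.
rewrite (hsym (block_sizes p) (cell_sizes (push_partition f p))); last 2 first.
- exact: cell_sizes_gt0.
- by rewrite perm_sym; apply: perm_cell_sizes_push; exact: bij_inj.
congr (_ * _); rewrite big_push_partition; last exact: bij_inj.
apply: eq_bigr => C _; congr (H _); apply/seteqP; split => x /= h.
- by move=> _ /imsetP[i iC ->]; exact: h.
- by move=> i /= iC; apply: h => /=; rewrite imset_f.
Qed.

(** The sample is indexed by pairs (cell j, element of the cell), and all the
    elements of cell j are required to fall in [B j].  A partition contributes
    only if each of its blocks lies inside one cell; it then has at least one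
    block per cell, and exactly one only if it is the partition into cells.  All
    others have at least one more factor eps.  The constant does not depend on
    eps, which is what makes the limit eps -> 0 usable. *)
Lemma eppf_expansion (e : seq nat) : all (leq 1) e ->
  exists K : R, forall (eps : R) (B : nat -> set R), (0 <= eps <= 1)%R ->
    (forall j, measurable (B j)) ->
    (forall i j, (i < size e)%N -> (j < size e)%N -> i != j ->
       B i `&` B j = set0) ->
    (forall j, (j < size e)%N -> H (B j) = eps%:E) ->
  exists2 x : R,
    \int[P]_w \prod_(j < size e) \prod_(l < nth 0%N e j) G w (B j) = x%:E &
    (`|x - chi e * eps ^+ size e| <= K * eps ^+ (size e).+1)%R.
Proof.
move=> e_gt0; pose J : finType := {j : 'I_(size e) & 'I_(nth 0%N e j)}.
have e0 (j : 'I_(size e)) : (0 < nth 0%N e j)%N.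
  by have /allP := e_gt0; apply; exact: mem_nth.
pose x0 (j : 'I_(size e)) : J :=
  Tagged (fun j : 'I_(size e) => 'I_(nth 0%N e j)) (Ordinal (e0 j)).
pose fib (j : 'I_(size e)) : {set J} := [set x : J | tag x == j]%SET.
have card_fib j : #|fib j| = nth 0%N e j.
  rewrite -sum1_card (eq_bigl (fun x : J => tag x == j)); last by move=> x; rewrite inE.
  under eq_bigl do rewrite -[_ == _]andbT.
  rewrite -(sig_big_dep (fun i => i == j) (fun _ => xpredT) (fun _ _ => 1%N)).
  by rewrite big_pred1_eq /= sum1_card card_ord.
pose P0 : {set {set J}} := [set fib j | j : 'I_(size e)]%SET.
have fib_inj : injective fib.
  by move=> i j /setP/(_ (x0 i)); rewrite !inE /= eqxx => /esym/eqP.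
have partP0 : finset.partition P0 [set: J]%SET.
  apply/and3P; split.
  - rewrite finset.eqEsubset finset.subsetT /=; apply/fintype.subsetP => x _.
    by apply/finset.bigcupP; exists (fib (tag x)); rewrite ?imset_f ?inE.
  - apply/finset.trivIsetP => _ _ /imsetP[i _ ->] /imsetP[j _ ->] ij.
    rewrite -finset.setI_eq0; apply/eqP/setP => x; rewrite !inE.
    by apply/negP => /andP[/eqP xi /eqP xj]; rewrite -xi -xj eqxx in ij.
  - apply/imsetP => -[j _ /setP /(_ (x0 j))]; rewrite !inE /=.
    by rewrite eqxx.
have sizesP0 : chi (cell_sizes P0) = chi e.
  have [_ hsym _] := hchi; apply: hsym; first exact: cell_sizes_gt0.
  rewrite /cell_sizes.
  apply: (@perm_trans _
    [seq #|C : {set J}| | C <- [seq fib j | j <- enum 'I_(size e)]]).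
    apply: perm_map; apply: uniq_perm; rewrite ?enum_uniq //.
      by rewrite map_inj_uniq // enum_uniq.
    move=> C; rewrite mem_enum; apply/imsetP/mapP => -[j _ ->]; exists j => //.
    by rewrite mem_enum.
  rewrite -map_comp (eq_map card_fib).
  rewrite -[X in perm_eq _ X](mkseq_nth 0%N) /mkseq -val_enum_ord -map_comp.
  exact: perm_refl.
exists (\sum_(p : {set {set J}} | finset.partition p [set: J]%SET)
         `|chi (cell_sizes p)|)%R.
move=> eps B /andP[eps0 eps1] mB disB hB.
(* [c p] is the product over the blocks of [p] in the joint law: eps per block if
   every block lies in one cell, and 0 otherwise. *)
pose c (p : {set {set J}}) : R :=
  if [forall C in p, forall x in C, forall y in C, tag x == tag y]
  then (eps ^+ #|p|)%R else 0%R.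
exists (\sum_(p : {set {set J}} | finset.partition p [set: J]%SET)
         chi (cell_sizes p) * c p)%R.
  transitivity (\int[P]_w \prod_(x : J) G w (B (tag x))).
    apply: eq_integral => w _.
    by rewrite (sig_big_dep xpredT (fun _ => xpredT)
      (fun (j : 'I_(size e)) (_ : 'I_(nth 0%N e j)) => G w (B j))).
  rewrite eppf_rectangle; last by move=> x; exact: mB.
  rewrite -sumEFin; apply: eq_bigr => p pp; rewrite EFinM; congr (_ * _).
  rewrite /c; case: ifPn => [/forall_inP mono|].
    transitivity (\prod_(C in p) eps%:E).
      apply: eq_bigr => C Cp.
      have /finset.set0Pn[x xC] := partition_neq0 pp Cp.
      rewrite -(hB (tag x)) //; congr (H _); apply/seteqP; split => r /=.
        by apply.
      move=> Br y /= yC.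
      by have /forall_inP/(_ x xC)/forall_inP/(_ y yC)/eqP <- := mono C Cp.
    by rewrite prodEFin prodr_const.
  move=> /forall_inPn[C Cp /forall_inPn[x xC /forall_inPn[y yC xy]]].
  rewrite (bigD1 C) //= [X in H X](_ : _ = set0) ?measure0 ?mul0e //.
  apply/seteqP; split => // r h.
  by rewrite -(disB (tag x) (tag y)) //; split; apply: h.
rewrite (bigD1 P0 partP0) /= sizesP0.
have -> : c P0 = (eps ^+ size e)%R.
  rewrite /c card_imset // card_ord ifT //; apply/forall_inP => _ /imsetP[j _ ->].
  apply/forall_inP => x; rewrite inE => /eqP ->.
  by apply/forall_inP => y; rewrite inE => /eqP ->.
rewrite addrAC subrr add0r (bigD1 P0 partP0 (F := fun p => `|chi (cell_sizes p)|)%R) /= mulrDl.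
rewrite (le_trans (ler_norm_sum _ _ _)) // mulr_suml.
rewrite ler_wpDl ?mulr_ge0 ?exprn_ge0 //.
apply: ler_sum => p /andP[pp pP0]; rewrite normrM ler_wpM2l //.
rewrite /c; case: ifPn => [/forall_inP mono|_]; last by rewrite normr0 exprn_ge0.
rewrite ger0_norm ?exprn_ge0 //; apply: ler_wiXn2l => //.
have /and3P[/eqP covp trp p0] := pp.
(* The block of the first element of cell j: an injection of the cells into the
   blocks, so it remains to see that a bijection forces [p = P0]. *)
pose cl (j : 'I_(size e)) : {set J} := finset.pblock p (x0 j).
have clp j : cl j \in p by rewrite pblock_mem // covp inE.
have cl_mono C x y : C \in p -> x \in C -> y \in C -> tag x = tag y.
  by move=> Cp xC yC; have /forall_inP/(_ x xC)/forall_inP/(_ y yC)/eqP := mono C Cp.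
have x0cl j : x0 j \in cl j by rewrite mem_pblock covp inE.
have cl_inj : injective cl.
  move=> i j ij; rewrite -[i]/(tag (x0 i)) -[j]/(tag (x0 j)).
  by apply: (cl_mono (cl i)) => //; rewrite ij.
have sub : [set cl j | j : 'I_(size e)]%SET \subset p.
  by apply/fintype.subsetP => _ /imsetP[j _ ->].
have := subset_leq_card sub; rewrite card_imset // card_ord.
rewrite leq_eqVlt => /orP[/eqP sz|//]; exfalso; move/negP: pP0; apply; apply/eqP.
have /eqP eqp : [set cl j | j : 'I_(size e)]%SET == p.
  by rewrite eqEcard sub /= card_imset // card_ord -sz.
rewrite -eqp; apply: eq_imset => j; apply/setP => x; rewrite inE.
apply/idP/eqP => [xj|xj].
  by rewrite -[j]/(tag (x0 j)); apply: (cl_mono (cl j)).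
have : finset.pblock p x \in p by rewrite pblock_mem // covp inE.
rewrite -{2}eqp => /imsetP[k _ pk].
have xk : x \in cl k by rewrite -pk mem_pblock covp inE.
suff <- : k = j by [].
by rewrite -xj -[LHS]/(tag (x0 k)); apply: (cl_mono (cl k)).
Qed.

End EPPF.

(** * Nonnegativity and support of the partition probability function *)

Lemma archimedean_le0 (R : realType) (a b : R) :
  (forall n : nat, n.+1%:R * a <= b) -> a <= 0.
Proof.
move=> h; rewrite leNgt; apply/negP => a0.
have b0 : 0 <= b by apply: (le_trans _ (h 0)); rewrite mul1r ltW.
have := h (Num.truncn (b / a)); apply/negP; rewrite -ltNge.
by rewrite -ltr_pdivrMr // truncnS_gt.
Qed.

Section EPPFSupport.
Context d (Omega : measurableType d) (R : realType) (P : probability Omega R).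
Context (H : probability R R) (G : R.-pker Omega ~> R) (chi : seq nat -> R).
Hypothesis H_nonatomic : forall x : R, H [set x] = 0%E.
Hypothesis hchi : is_eppf P H G chi.

Let pker_le1 w A : measurable A -> (0 <= G w A <= 1)%E.
Proof.
move=> mA; rewrite measure_ge0 /= -(prob_kernel (s := G) w).
by apply: le_measure; rewrite ?inE.
Qed.

Let disjoint_cells (B : nat -> set R) i j :
  trivIset setT B -> i != j -> B i `&` B j = set0.
Proof. by move/trivIsetP => tB ij; exact: tB. Qed.

(** The left side of the expansion is nonnegative and chi(e) is its leading
    coefficient. *)
Lemma eppf_ge0 (e : seq nat) : all (leq 1) e -> 0 <= chi e.
Proof.
move=> e_gt0; have [K hK] := eppf_expansion hchi e_gt0.
rewrite -oppr_le0; set r := size e in hK *.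
apply: (@archimedean_le0 _ _ (K + r%:R * chi e)) => n.
have [B [mB tB hB]] := nonatomic_split H_nonatomic (ltn0Sn (n + r)).
have [| |i j _ _ ij|j jr|x Ex] := hK (n + r).+1%:R^-1 B => //.
- by rewrite invr_ge0 ler0n invf_le1 ?ltr0n// ler1n.
- exact: disjoint_cells.
- by rewrite hB // ltnS (leq_trans (ltnW jr)) // leq_addl.
have x0 : 0 <= x.
  rewrite -lee_fin -Ex; apply: integral_ge0 => w _; apply: prode_ge0 => j _.
  by apply: prode_ge0.
rewrite ler_distl => /andP[_].
set u := _.+1%:R^-1 => hx.
have u0 : 0 < u by rewrite invr_gt0.
have : 0 <= (chi e + K * u) * u ^+ r.
  by apply: (le_trans x0); apply: (le_trans hx); rewrite exprS; lra.
rewrite pmulr_lge0 ?exprn_gt0 //.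
have -> : K * u = K / (n.+1%:R + r%:R) by rewrite /u -natrD addSn.
have nr0 : 0 < n.+1%:R + r%:R :> R by rewrite -natrD addSn.
rewrite -(pmulr_lge0 _ nr0) mulrDl divfK; last by rewrite gt_eqF.
lra.
Qed.

(** Compare the expansions for [e] and for [rcons e k] when the additional cell is
    placed in each of the n + 1 remaining pieces of mass eps = 1/(n + 1 + size e).
    Since the sum over these pieces B of G(B)^k is at most 1, the sum of the n + 1
    expectations is at most the expectation for [e], which is O(eps^(size e + 1))
    when chi(e) = 0.  Dividing by eps^(size e + 1) bounds (n + 1) chi(rcons e k)
    independently of n. *)
Lemma eppf_rcons_eq0 (e : seq nat) (k : nat) :
  all (leq 1) e -> (0 < k)%N -> chi e = 0 -> chi (rcons e k) = 0.
Proof.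
move=> e_gt0 k0 chi0.
have e'_gt0 : all (leq 1) (rcons e k) by rewrite all_rcons k0.
apply/eqP; rewrite eq_le eppf_ge0 // andbT.
have [K hK] := eppf_expansion hchi e_gt0.
have [K' hK'] := eppf_expansion hchi e'_gt0.
set r := size e in hK *; rewrite size_rcons -/r in hK'.
apply: (@archimedean_le0 _ _ (K + `|K'|)) => n.
have [B [mB tB hB]] := nonatomic_split H_nonatomic (ltn0Sn (n + r)).
have [| |i j _ _ ij|j jr|z Ez hz] := hK (n + r).+1%:R^-1 B => //.
- by rewrite invr_ge0 ler0n invf_le1 ?ltr0n// ler1n.
- exact: disjoint_cells.
- by rewrite hB // ltnS (leq_trans (ltnW jr)) // leq_addl.
pose B' (i : nat) j := B (if j == r then (r + i)%N else j).
have /choice[y hy] (i : 'I_n.+1) : exists y : R,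
    (\int[P]_w \prod_(j < r.+1) \prod_(l < nth 0%N (rcons e k) j)
       G w (B' i j) = y%:E)%E /\
    `|y - chi (rcons e k) * (n + r).+1%:R^-1 ^+ r.+1| <=
       K' * (n + r).+1%:R^-1 ^+ r.+2.
  have [| |a b ar br ab|j jr|y Ey hy] := hK' (n + r).+1%:R^-1 (B' i).
  - by rewrite invr_ge0 ler0n invf_le1 ?ltr0n// ler1n.
  - by move=> j; exact: mB.
  - rewrite /B'; apply: disjoint_cells => //.
    by move/eqP: ab => ab; apply/negP => /eqP; case: (a =P r); case: (b =P r); lia.
  - by rewrite /B' hB //; case: (j =P r) => jE; have := ltn_ord i; lia.
  - by exists y.
have : \sum_(i < n.+1) y i <= z.
  rewrite -lee_fin -sumEFin -Ez.
  under eq_bigr do rewrite -(hy _).1.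
  have mG j : measurable_fun setT (fun w => G w (B j)).
    exact: measurable_kernel.
  rewrite -ge0_integral_sum //; last 2 first.
  - move=> i; apply: emeasurable_prod => j _; apply: emeasurable_prod => l _.
    exact: mG.
  - by move=> i w _; apply: prode_ge0 => j _; exact: prode_ge0.
  apply: ge0_le_integral => //.
  - by move=> w _; apply: sume_ge0 => i _; apply: prode_ge0 => j _; exact: prode_ge0.
  - apply: emeasurable_sum => i; apply: emeasurable_prod => j _.
    by apply: emeasurable_prod => l _; exact: mG.
  - by apply: emeasurable_prod => j _; apply: emeasurable_prod => l _; exact: mG.
  move=> w _; set D := (X in (_ <= X)%E).
  have D0 : (0 <= D)%E by apply: prode_ge0 => j _; exact: prode_ge0.
  rewrite (eq_bigr (fun i : 'I_n.+1 => D * \prod_(l < k) G w (B (r + i)%N))%E); last first.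
    move=> i _; rewrite big_ord_recr /= nth_rcons ltnn eqxx /B' eqxx.
    congr (_ * _)%E; apply: eq_bigr => j _; rewrite nth_rcons ltn_ord.
    by rewrite ltn_eqF.
  rewrite -ge0_sume_distrr; last by move=> i _; exact: prode_ge0.
  rewrite -[leRHS]mule1 lee_wpmul2l //.
  apply: (@le_trans _ _ (\sum_(i < n.+1) G w (B (r + i)%N))%E).
    apply: lee_sum => i _; case: k k0 {e'_gt0 hK' hy} => // k _.
    rewrite big_ord_recl -[leRHS]mule1 lee_wpmul2l //.
    by have /andP[] : (0 <= \prod_(l < k) G w (B (r + i)%N) <= 1)%E
      by apply: prode_le1 => l _; exact: pker_le1.
  rewrite -(@measure_bigsetU _ _ _ (G w) (fun i => B (r + i)%N)) //.
    by have /andP[] : (0 <= G w (\big[setU/set0]_(i < n.+1) B (r + i)%N) <= 1)%E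
      by apply: pker_le1; exact: bigsetU_measurable.
  apply/trivIsetP => i j _ _ ij; apply: disjoint_cells => //.
  by rewrite eqn_add2l.
move=> yz; move: hz; rewrite chi0 mul0r subr0 => /ler_normlW zK.
have := le_trans yz zK => {yz zK}.
set c := chi (rcons e k) in hy *; set u := _.+1%:R^-1 in hy *.
have u0 : 0 < u by rewrite invr_gt0.
have lo (i : 'I_n.+1) : (c - K' * u) * u ^+ r.+1 <= y i.
  have [_] := hy i; rewrite ler_distl => /andP[+ _].
  by rewrite [u ^+ r.+2]exprS; lra.
move=> hi; have : \sum_(i < n.+1) (c - K' * u) * u ^+ r.+1 <= K * u ^+ r.+1.
  by apply: le_trans hi; apply: ler_sum => i _.
rewrite sumr_const card_ord -[leLHS]mulr_natl mulrA ler_pM2r ?exprn_gt0 //.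
have : n.+1%:R * u * K' <= `|K'|.
  rewrite (le_trans (ler_norm _)) // normrM ler_piMl //.
  have nu0 : 0 <= n.+1%:R * u by rewrite mulr_ge0 // ltW.
  by rewrite ger0_norm // /u ler_pdivrMr ?ltr0n // mul1r ler_nat; lia.
lra.
Qed.

Lemma eppf_cat_eq0 (e e' : seq nat) :
  all (leq 1) e -> all (leq 1) e' -> chi e = 0 -> chi (e ++ e') = 0.
Proof.
move=> e_gt0; elim/last_ind: e' => [|e' k ih]; first by rewrite cats0.
rewrite all_rcons => /andP[k0 e'0] chi0; rewrite -rcons_cat.
by apply: eppf_rcons_eq0; rewrite ?ih // all_cat e_gt0.
Qed.

End EPPFSupport.

(** * Nonnegative functionals determined by indicators *)

Section MonotoneLinearFunctionals.
Context d (T : measurableType d) (R : realType).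
Local Open Scope ereal_scope.

Definition nonneg_measurable (f : T -> \bar R) : Prop :=
  measurable_fun setT f /\ forall x, 0 <= f x.

(** The properties of integration that suffice to pass from indicators to
    nonnegative measurable functions.  Working with functionals rather than
    measures avoids building the measures A |-> Phi(1_A). *)
Record monotone_linear (Phi : (T -> \bar R) -> \bar R) : Prop := {
  ml_ge0 : forall f, nonneg_measurable f -> 0 <= Phi f ;
  ml_le : forall f g, nonneg_measurable f -> nonneg_measurable g ->
    (forall x, f x <= g x) -> Phi f <= Phi g ;
  mlD : forall f g, nonneg_measurable f -> nonneg_measurable g ->
    Phi (fun x => f x + g x) = Phi f + Phi g ;
  mlZ : forall (c : R) f, (0 <= c)%R -> nonneg_measurable f ->
    Phi (fun x => c%:E * f x) = c%:E * Phi f ;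
  ml_lim : forall (f_ : nat -> T -> \bar R) f,
    (forall n, nonneg_measurable (f_ n)) -> nonneg_measurable f ->
    (forall x, nondecreasing_seq (f_^~ x)) ->
    (forall x, f_ n x @[n --> \oo] --> f x) ->
    Phi (f_ n) @[n --> \oo] --> Phi f }.

Lemma nonneg_measurable_indic (A : set T) : measurable A ->
  nonneg_measurable (fun x => (\1_A x)%:E).
Proof.
move=> mA; split; last by move=> x; rewrite lee_fin.
exact/measurable_EFinP/measurable_indic.
Qed.

Lemma nonneg_measurableD f g : nonneg_measurable f -> nonneg_measurable g ->
  nonneg_measurable (fun x => f x + g x).
Proof.
move=> [mf f0] [mg g0]; split; first exact: emeasurable_funD.
by move=> x; rewrite adde_ge0.
Qed.

Lemma nonneg_measurableZ (c : R) f : (0 <= c)%R -> nonneg_measurable f ->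
  nonneg_measurable (fun x => c%:E * f x).
Proof.
move=> c0 [mf f0]; split; first exact: measurable_funeM.
by move=> x; rewrite mule_ge0.
Qed.

Lemma nonneg_measurable_step (A : R -> set T) (s : seq R) :
  (forall y, measurable (A y)) -> (forall y, y \in s -> (0 <= y)%R) ->
  nonneg_measurable (fun x => \sum_(y <- s) y%:E * (\1_(A y) x)%:E).
Proof.
move=> mA; elim: s => [|y s ih] s0.
  rewrite (_ : (fun _ => _) = cst 0); first by split.
  by apply/funext => x; rewrite big_nil.
rewrite (_ : (fun _ => _) =
  fun x => y%:E * (\1_(A y) x)%:E + \sum_(y <- s) y%:E * (\1_(A y) x)%:E);
  last by apply/funext => x; rewrite big_cons.
apply: nonneg_measurableD; last first.
  by apply: ih => z zs; apply: s0; rewrite inE zs orbT.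
apply: nonneg_measurableZ; last exact: nonneg_measurable_indic.
by apply: s0; rewrite inE eqxx.
Qed.

Lemma ml_step Phi (A : R -> set T) (s : seq R) : monotone_linear Phi ->
  (forall y, measurable (A y)) -> (forall y, y \in s -> (0 <= y)%R) ->
  Phi (fun x => \sum_(y <- s) y%:E * (\1_(A y) x)%:E) =
  \sum_(y <- s) y%:E * Phi (fun x => (\1_(A y) x)%:E).
Proof.
move=> mlPhi mA; elim: s => [|y s ih] s0.
  have -> : (fun x => \sum_(y <- [::]) y%:E * (\1_(A y) x)%:E) =
      (fun x => 0%:E * (\1_(A 0%R) x)%:E).
    by apply/funext => x; rewrite big_nil mul0e.
  by rewrite mlZ ?mul0e ?big_nil //; exact: nonneg_measurable_indic.
have s0' z : z \in s -> (0 <= z)%R.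
  by move=> zs; apply: s0; rewrite inE zs orbT.
have y0 : (0 <= y)%R by apply: s0; rewrite inE eqxx.
have -> : (fun x => \sum_(y <- y :: s) y%:E * (\1_(A y) x)%:E) =
  fun x => y%:E * (\1_(A y) x)%:E + \sum_(y <- s) y%:E * (\1_(A y) x)%:E.
  by apply/funext => x; rewrite big_cons.
rewrite (mlD mlPhi); last 2 first.
- exact/nonneg_measurableZ/nonneg_measurable_indic.
- exact: nonneg_measurable_step.
rewrite ih // big_cons (mlZ mlPhi) //; exact: nonneg_measurable_indic.
Qed.

Import HBNNSimple.

(** A nonnegative measurable function is an increasing limit of finite sums of
    multiples of indicators. *)
Lemma monotone_linear_ext Phi Psi :
  monotone_linear Phi -> monotone_linear Psi ->
  (forall A, measurable A ->
     Phi (fun x => (\1_A x)%:E) = Psi (fun x => (\1_A x)%:E)) ->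
  forall f, nonneg_measurable f -> Phi f = Psi f.
Proof.
move=> mPhi mPsi h f nf; have [mf f0] := nf.
pose f_ n : T -> \bar R := EFin \o nnsfun_approx measurableT mf n.
have f_E n : exists A (s : seq R), [/\ forall y, measurable (A y),
    forall y, y \in s -> (0 <= y)%R &
    f_ n = fun x => \sum_(y <- s) y%:E * (\1_(A y) x)%:E].
  set g := nnsfun_approx measurableT mf n.
  exists (fun y => g @^-1` [set y]), (finmap.enum_fset (fset_set (range g))).
  split=> [y|y|].
  - exact: measurable_funPTI.
  - by rewrite in_fset_set // inE => -[x _ <-].
  apply/funext => x; rewrite /f_ /= -/g fimfunE fsbig_finite //= -sumEFin.
  by apply: eq_bigr => y _; rewrite EFinM.
have nf_ n : nonneg_measurable (f_ n).
  by have [A [s [mA s0 ->]]] := f_E n; exact: nonneg_measurable_step.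
have f_nd x : nondecreasing_seq (f_^~ x).
  by move=> a b ab; rewrite lee_fin; exact/lefP/nd_nnsfun_approx.
have f_lim x : f_ n x @[n --> \oo] --> f x by exact: cvg_nnsfun_approx.
have cPhi := ml_lim mPhi nf_ nf f_nd f_lim.
have := ml_lim mPsi nf_ nf f_nd f_lim.
rewrite (_ : (fun n => Psi (f_ n)) = (fun n => Phi (f_ n))); last first.
  apply/funext => n; have [A [s [mA s0 ->]]] := f_E n.
  by rewrite !ml_step //; apply: eq_bigr => y _; rewrite h.
exact: cvg_unique cPhi.
Qed.

Lemma monotone_linear_eval x : monotone_linear (fun f => f x).
Proof. by split=> // f [_ f0]. Qed.

Lemma monotone_linear0 : monotone_linear (fun _ => 0).
Proof.
split=> //; first by move=> *; rewrite adde0.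
  by move=> *; rewrite mule0.
by move=> *; exact: cvg_cst.
Qed.

Lemma monotone_linearD Phi Psi : monotone_linear Phi -> monotone_linear Psi ->
  monotone_linear (fun f => Phi f + Psi f).
Proof.
move=> mPhi mPsi; split.
- by move=> f nf; rewrite adde_ge0 // ml_ge0.
- by move=> f g nf ng fg; rewrite leeD // ml_le.
- by move=> f g nf ng; rewrite !mlD // addeACA.
- by move=> c f c0 nf; rewrite !mlZ // ge0_muleDr // ml_ge0.
- move=> f_ f nf_ nf f_nd f_lim; apply: cvgeD; try exact: ml_lim.
  by apply: ge0_adde_def; rewrite inE ml_ge0.
Qed.

Lemma monotone_linearZ (c : R) Phi : (0 <= c)%R -> monotone_linear Phi ->
  monotone_linear (fun f => c%:E * Phi f).
Proof.
move=> c0 mPhi; split.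
- by move=> f nf; rewrite mule_ge0 // ml_ge0.
- by move=> f g nf ng fg; rewrite lee_wpmul2l // ml_le.
- by move=> f g nf ng; rewrite mlD // ge0_muleDr // ml_ge0.
- by move=> b f b0 nf; rewrite mlZ // muleCA.
- by move=> f_ f nf_ nf f_nd f_lim; apply: cvgeZl => //; exact: ml_lim.
Qed.

Lemma monotone_linear_sum (I : Type) (s : seq I) (Q : pred I)
    (Phi : I -> (T -> \bar R) -> \bar R) :
  (forall i, Q i -> monotone_linear (Phi i)) ->
  monotone_linear (fun f => \sum_(i <- s | Q i) Phi i f).
Proof.
move=> mPhi; elim: s => [|i s ih].
  rewrite (_ : (fun _ => _) = fun _ => 0); first exact: monotone_linear0.
  by apply/funext => f; rewrite big_nil.
case: (boolP (Q i)) => Qi.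
  rewrite (_ : (fun _ => _) =
      fun f => Phi i f + \sum_(i <- s | Q i) Phi i f).
    by apply: monotone_linearD => //; exact: mPhi.
  by apply/funext => f; rewrite big_cons Qi.
rewrite (_ : (fun _ => _) = fun f => \sum_(i <- s | Q i) Phi i f) //.
by apply/funext => f; rewrite big_cons (negbTE Qi).
Qed.

End MonotoneLinearFunctionals.

(** Mixtures: both an integral with a density and the average of random integrals
    have this form. *)
Lemma monotone_linear_integral d (T : measurableType d) (R : realType)
    d' (X : measurableType d') (mu : {measure set X -> \bar R})
    (b : X -> \bar R) (phi : X -> (T -> \bar R) -> \bar R) :
  measurable_fun setT b -> (forall x, 0 <= b x)%E ->
  (forall x, b x \is a fin_num) -> (forall x, monotone_linear (phi x)) ->
  (forall f, nonneg_measurable f -> measurable_fun setT (phi ^~ f)) ->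
  monotone_linear (fun f => \int[mu]_x (b x * phi x f))%E.
Proof.
move=> mb b0 bfin ml_phi mphi.
have mbphi f : nonneg_measurable f -> measurable_fun setT (fun x => b x * phi x f)%E.
  by move=> nf; apply: emeasurable_funM => //; exact: mphi.
have bphi0 f x : nonneg_measurable f -> (0 <= b x * phi x f)%E.
  by move=> nf; rewrite mule_ge0 // ml_ge0.
split.
- by move=> f nf; apply: integral_ge0 => x _; exact: bphi0.
- move=> f g nf ng fg; apply: ge0_le_integral => //.
  + by move=> x _; exact: bphi0.
  + exact: mbphi.
  + exact: mbphi.
  + by move=> x _; rewrite lee_wpmul2l // ml_le.
- move=> f g nf ng; rewrite -ge0_integralD //; try exact: mbphi;
    try (by move=> x _; exact: bphi0).
  by apply: eq_integral => x _; rewrite mlD // ge0_muleDr // ml_ge0.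
- move=> c f c0 nf; rewrite -ge0_integralZl //; [|exact: mbphi|by move=> x _; exact: bphi0].
  by apply: eq_integral => x _; rewrite mlZ // muleCA.
- move=> f_ f nf_ nf f_nd f_lim.
  rewrite (_ : (\int[mu]_x (b x * phi x f))%E =
      (\int[mu]_x limn (fun n => b x * phi x (f_ n)))%E).
    apply: (@cvg_monotone_convergence _ _ _ mu _ measurableT
      (fun n x => b x * phi x (f_ n))%E).
    + by move=> n; exact: mbphi.
    + by move=> n x _; exact: bphi0.
    + move=> x _ m n mn; rewrite lee_wpmul2l // ml_le // => y; exact: f_nd.
  apply: eq_integral => x _; apply/esym/cvg_lim => //.
  by apply: cvgeZl => //; exact: ml_lim.
Qed.

Section BoundedFunctions.
Context d (T : measurableType d) (R : realType).
Local Open Scope ereal_scope.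

(** Boundedness keeps all the integrals finite, so that products of integrals are
    products of real numbers and commute with limits. *)
Definition bounded_nonneg (f : T -> \bar R) : Prop :=
  nonneg_measurable f /\ exists M : R, forall x, f x <= M%:E.

Lemma bounded_nonneg_fin_num f x : bounded_nonneg f -> f x \is a fin_num.
Proof.
move=> [[_ f0] [M fM]]; rewrite ge0_fin_numE //.
exact: le_lt_trans (fM x) (ltry _).
Qed.

Lemma bounded_nonneg_indic (A : set T) : measurable A ->
  bounded_nonneg (fun x => (\1_A x)%:E).
Proof.
move=> mA; split; first exact: nonneg_measurable_indic.
by exists 1%R => x; rewrite lee_fin indicE; case: (_ \in _).
Qed.

Lemma bounded_nonneg_prod (I : Type) (s : seq I) (Q : pred I)
    (f : I -> T -> \bar R) : (forall i, Q i -> bounded_nonneg (f i)) ->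
  bounded_nonneg (fun x => \prod_(i <- s | Q i) f i x).
Proof.
move=> bf; split; first split.
- by apply: emeasurable_prod => i Qi; have [[]] := bf i Qi.
- by move=> x; apply: prode_ge0 => i Qi; have [[]] := bf i Qi.
elim: s => [|i s [M hM]].
  by exists 1%R => x; rewrite big_nil.
case: (boolP (Q i)) => Qi; last first.
  by exists M => x; rewrite big_cons (negbTE Qi).
have [[_ fi0] [K fK]] := bf i Qi.
exists (K * M)%R => x; rewrite big_cons Qi EFinM; apply: lee_pmul => //.
by apply: prode_ge0 => j Qj; have [[_ +] _] := bf j Qj; apply.
Qed.

Lemma integral_bounded_nonneg (mu : {measure set T -> \bar R}) f :
  mu setT = 1 -> bounded_nonneg f ->
  exists2 M : R, (0 <= M)%R & \int[mu]_x f x = M%:E.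
Proof.
move=> mu1 [[mf f0] [M fM]].
have i0 : 0 <= \int[mu]_x f x by apply: integral_ge0.
have ifin : \int[mu]_x f x \is a fin_num.
  rewrite ge0_fin_numE //; apply: (@le_lt_trans _ _ (\int[mu]_x M%:E)).
    by apply: ge0_le_integral.
  by rewrite integral_cst // mu1 mule1 ltry.
exists (fine (\int[mu]_x f x)); first by rewrite fine_ge0.
by rewrite fineK.
Qed.

End BoundedFunctions.

Lemma monotone_linear_int d (T : measurableType d) (R : realType)
    (mu : {measure set T -> \bar R}) :
  monotone_linear (fun f => \int[mu]_x f x)%E.
Proof.
rewrite (_ : (fun _ => _) = fun f => \int[mu]_x (1 * f x))%E; last first.
  by apply/funext => f; apply: eq_integral => x _; rewrite mul1e.
apply: (monotone_linear_integral mu (phi := fun x f => f x)) => //.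
- by move=> x; exact: monotone_linear_eval.
- by move=> f [].
Qed.

(** * The partition probability function on products of functions *)

Section EPPFFunctions.
Context d (Omega : measurableType d) (R : realType) (P : probability Omega R).
Context (H : probability R R) (G : R.-pker Omega ~> R) (chi : seq nat -> R).
Hypothesis H_nonatomic : forall x : R, H [set x] = 0%E.
Hypothesis hchi : is_eppf P H G chi.
Variable J : finType.
Local Open Scope ereal_scope.

Let subst_at (k : J -> R -> \bar R) (i : J) (f : R -> \bar R) (j : J) :=
  if j == i then f else k j.

Let lhs (k : J -> R -> \bar R) := \int[P]_w \prod_(j : J) \int[G w]_x k j x.
Let rhs (k : J -> R -> \bar R) :=
  \sum_(p : {set {set J}} | finset.partition p [set: J]%SET)
    (chi (cell_sizes p))%:E *
    \prod_(C in p) \int[H]_x \prod_(j in C) k j x.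

(* Only the factor of index i depends on f; the others form the weight. *)
Let lhs_monotone_linear k i : (forall j, bounded_nonneg (k j)) ->
  monotone_linear (fun f => lhs (subst_at k i f)).
Proof.
move=> bk.
rewrite (_ : (fun _ => _) = fun f => \int[P]_w
    ((\prod_(j | j != i) \int[G w]_x k j x) * \int[G w]_x f x)); last first.
  apply/funext => f; apply: eq_integral => w _.
  rewrite (bigD1 i) //= muleC; congr (_ * _).
    by apply: eq_bigr => j ji; rewrite /subst_at (negbTE ji).
  by rewrite /subst_at eqxx.
have mint f : nonneg_measurable f -> measurable_fun setT (fun w => \int[G w]_x f x).
  move=> [mf f0]; apply: measurable_fun_integral_kernel => // U mU.
  exact: measurable_kernel.
apply: monotone_linear_integral => //.
- by apply: emeasurable_prod => j _; apply: mint; have [] := bk j.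
- move=> w; apply: prode_ge0 => j _; apply: integral_ge0 => x _.
  by have [[]] := bk j.
- move=> w; apply: prode_fin_num => j _.
  by have [M _ ->] := integral_bounded_nonneg (prob_kernel (s := G) w) (bk j).
- by move=> w; exact: monotone_linear_int.
Qed.

(* In each partition only the block containing i depends on f.  Monotonicity is
   where chi >= 0 matters. *)
Let rhs_monotone_linear k i : (forall j, bounded_nonneg (k j)) ->
  monotone_linear (fun f => rhs (subst_at k i f)).
Proof.
move=> bk; apply: monotone_linear_sum => p pp.
apply: monotone_linearZ.
  exact: (eppf_ge0 H_nonatomic hchi (cell_sizes_gt0 pp)).
have /and3P[/eqP covp trp _] := pp.
pose Ci := finset.pblock p i.
have Cip : Ci \in p by rewrite pblock_mem // covp inE.
have iCi : i \in Ci by rewrite mem_pblock covp inE.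
have bC (Q : pred J) : bounded_nonneg (fun x => \prod_(j | Q j) k j x).
  by apply: bounded_nonneg_prod => j _.
have HT : H setT = 1 by exact: probability_setT.
pose D := \prod_(C in p | C != Ci) \int[H]_x \prod_(j in C) k j x.
have D0 : 0 <= D.
  apply: prode_ge0 => C _; have [M M0 ->] := integral_bounded_nonneg HT (bC (mem C)).
  by rewrite lee_fin.
have DE : (fine D)%:E = D.
  rewrite fineK //; apply: prode_fin_num => C _.
  by have [M _ ->] := integral_bounded_nonneg HT (bC (mem C)).
rewrite (_ : (fun _ => _) = fun f => (fine D)%:E *
    \int[H]_x ((\prod_(j in Ci | j != i) k j x) * f x)).
  apply: monotone_linearZ; first by rewrite fine_ge0.
  apply: (monotone_linear_integral H (phi := fun x f => f x)).
  - by have [[]] := bC (fun j => (j \in Ci) && (j != i)).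
  - by have [[]] := bC (fun j => (j \in Ci) && (j != i)).
  - by move=> x; exact: (bounded_nonneg_fin_num x (bC _)).
  - by move=> x; exact: monotone_linear_eval.
  - by move=> f [].
apply/funext => f; rewrite DE (bigD1 Ci) //= muleC; congr (_ * _).
  apply: eq_bigr => C /andP[Cp CCi]; apply: eq_integral => x _.
  apply: eq_bigr => j jC; rewrite /subst_at; case: eqP => // ji.
  by move: CCi; rewrite /Ci -ji (def_pblock trp Cp jC) eqxx.
apply: eq_integral => x _; rewrite (bigD1 i) //= muleC; congr (_ * _).
  by apply: eq_bigr => j /andP[_ ji]; rewrite /subst_at (negbTE ji).
by rewrite /subst_at eqxx.
Qed.

(** Multilinearity: both sides are monotone linear in each coordinate separately,
    so the indicators can be replaced by functions one coordinate at a time,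
    starting from the joint law on rectangles. *)
Lemma eppf_functions (k : J -> R -> \bar R) :
  (forall j, bounded_nonneg (k j)) ->
  \int[P]_w \prod_(j : J) \int[G w]_x k j x =
  \sum_(p : {set {set J}} | finset.partition p [set: J]%SET)
    (chi (cell_sizes p))%:E *
    \prod_(C in p) \int[H]_x \prod_(j in C) k j x.
Proof.
rewrite -/(lhs k) -/(rhs k).
(* Induction on the list s of the coordinates that need not be indicators. *)
suff main (s : seq J) : forall k, (forall j, bounded_nonneg (k j)) ->
    (forall j, j \notin s ->
       exists2 A, measurable A & k j = fun x => (\1_A x)%:E) -> lhs k = rhs k.
  move=> bk; apply: (main (enum J)) => // j; by rewrite mem_enum.
elim: s => [|i s ih] {}k bk hk.
  have /choice[A hA] (j : J) : exists A : set R,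
      measurable A /\ k j = fun x => (\1_A x)%:E.
    by have [A mA kA] := hk j isT; exists A.
  transitivity (\int[P]_w \prod_(j : J) G w (A j)).
    apply: eq_integral => w _; apply: eq_bigr => j _; have [mA kA] := hA j.
    by rewrite kA integral_indic // setIT.
  rewrite (eppf_rectangle hchi); last by move=> j; exact: (hA j).1.
  apply: eq_bigr => p pp; congr (_ * _); apply: eq_bigr => C _.
  transitivity (\int[H]_x (\1_(\bigcap_(j in [set j | j \in C]) A j) x)%:E).
    rewrite integral_indic ?setIT //.
    by apply: fin_bigcap_measurable => // j _; exact: (hA j).1.
  apply: eq_integral => x _.
  under [RHS]eq_bigr => j _ do rewrite (hA j).2.
  rewrite prodEFin; congr (_%:E).
  have [xC|xC] := pselect (forall j, j \in C -> A j x).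
    rewrite indicE mem_set; last by move=> j /= /xC.
    by rewrite big1 // => j jC; rewrite indicE mem_set //; exact: xC.
  rewrite indicE memNset; last by move=> h; apply: xC => j jC; exact: h.
  move/existsNP : xC => [j /not_implyP[jC nAj]].
  by rewrite (bigD1 j) //= indicE memNset // mul0r.
have kE : k = subst_at k i (k i).
  by apply/funext => j; rewrite /subst_at; case: eqP => // ->.
rewrite kE.
apply: (monotone_linear_ext (lhs_monotone_linear i bk) (rhs_monotone_linear i bk)).
  move=> A mA; apply: ih => [j|j js]; rewrite /subst_at; case: eqP => // ji.
  - exact: bounded_nonneg_indic.
  - by exists A.
  - by apply: hk; rewrite inE negb_or js andbT; apply/eqP.
by have [] := bk i.
Qed.

End EPPFFunctions.

(** * S-paths and set partitions *)

Section SPathOfPartition.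
Variable n : nat.
Implicit Types (p : {set {set 'I_n}}) (S : svec n) (C : {set 'I_n}).

(** The j-th coordinate of the S-path of a partition of {1, ..., n}: the number of
    elements in the cells contained in {1, ..., j}.  This coordinate increases
    exactly at the maximal elements of cells, by the size of the cell. *)
Definition completed_before p (j : nat) : nat :=
  #|[set x : 'I_n | [forall k in finset.pblock p x, (k < j)%N]]%SET|.

Definition spath_of p : svec n := [ffun j : 'I_n.+1 => inord (completed_before p j)].

Lemma is_cell_maxP C (i : 'I_n) :
  reflect (i \in C /\ forall k, k \in C -> (k <= i)%N) (is_cell_max C i).
Proof. by apply: (iffP andP) => -[iC /forall_inP]. Qed.

Section OnePartition.
Variable p : {set {set 'I_n}}.
Hypothesis part_p : finset.partition p [set: 'I_n]%SET.

Let cov_p : finset.cover p = [set: 'I_n]%SET.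
Proof. by have /and3P[/eqP] := part_p. Qed.

Let triv_p : finset.trivIset p.
Proof. by have /and3P[] := part_p. Qed.

Let mem_cell x : x \in finset.pblock p x.
Proof. by rewrite mem_pblock cov_p inE. Qed.

Let cell_in x : finset.pblock p x \in p.
Proof. by rewrite pblock_mem // cov_p inE. Qed.

Let cellE C x : C \in p -> x \in C -> finset.pblock p x = C.
Proof. exact: def_pblock triv_p. Qed.

Lemma completed_before0 : completed_before p 0 = 0%N.
Proof.
apply/eqP; rewrite cards_eq0 -finset.subset0; apply/fintype.subsetP => x.
by rewrite !inE => /forall_inP/(_ x (mem_cell x)).
Qed.

Lemma completed_before_all : completed_before p n = n.
Proof.
rewrite -[RHS]card_ord -cardsT; apply: eq_card => x.
by rewrite !inE; apply/forall_inP.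
Qed.

Lemma completed_before_le j : (j <= n)%N -> (completed_before p j <= j)%N.
Proof.
move=> jn; have w_inj : injective (widen_ord jn).
  by move=> a b /(congr1 val) /= /val_inj.
rewrite -[leqRHS]card_ord -(card_imset _ w_inj).
apply: subset_leq_card; apply/fintype.subsetP => x.
rewrite inE => /forall_inP/(_ x (mem_cell x)) xj.
by apply/imsetP; exists (Ordinal xj) => //; apply: val_inj.
Qed.

Lemma completed_before_homo j k : (j <= k)%N ->
  (completed_before p j <= completed_before p k)%N.
Proof.
move=> jk; apply: subset_leq_card; apply/fintype.subsetP => x.
rewrite !inE => /forall_inP h; apply/forall_inP => y /h yj.
exact: leq_trans jk.
Qed.

Lemma completed_before_max C (i : 'I_n) : C \in p -> is_cell_max C i ->
  completed_before p i.+1 = (completed_before p i + #|C|)%N.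
Proof.
move=> Cp /is_cell_maxP[iC Cmax].
rewrite /completed_before -cardsUI (_ : _ :&: C = finset.set0).
  rewrite cards0 addn0; apply: eq_card => x; rewrite !inE.
  apply/forall_inP/orP => [h|[/forall_inP h k /h|xC k]].
  - have [xC|xC] := boolP (x \in C); [by right|left].
    apply/forall_inP => k kx; rewrite ltn_neqAle -ltnS h // andbT.
    apply: contraNneq xC => /val_inj ki.
    by rewrite -(cellE Cp iC) -ki (cellE (cell_in x) kx) mem_cell.
  - exact: leqW.
  - by rewrite (cellE Cp xC) ltnS; exact: Cmax.
apply/setP => x; rewrite !inE; apply/negP => /andP[/forall_inP h xC].
by have := h i; rewrite (cellE Cp xC) iC ltnn => /(_ isT).
Qed.

Lemma completed_before_nomax (i : 'I_n) :
  (forall C, C \in p -> ~~ is_cell_max C i) ->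
  completed_before p i.+1 = completed_before p i.
Proof.
move=> h; apply: eq_card => x; rewrite !inE; apply/forall_inP/forall_inP.
- move=> hx k kx; rewrite ltn_neqAle -ltnS hx // andbT.
  apply: contraNneq (h _ (cell_in x)) => /val_inj ki.
  by apply/is_cell_maxP; rewrite -ki; split=> // l lx; rewrite ki -ltnS hx.
- by move=> hx k /hx; exact: leqW.
Qed.

Lemma scoord_spath_of j : (j <= n)%N ->
  scoord (spath_of p) j = completed_before p j.
Proof.
move=> jn; rewrite /scoord ffunE !inordK ?ltnS //.
by rewrite (leq_trans _ jn) // completed_before_le.
Qed.

Lemma spath_of_is_spath : is_spath (spath_of p).
Proof.
apply/and4P; split.
- by rewrite scoord_spath_of // completed_before0.
- by rewrite scoord_spath_of // completed_before_all.
- apply/allP => j; rewrite mem_index_iota => /andP[_ /ltnW jn].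
  by rewrite scoord_spath_of // completed_before_le.
- apply/allP => j; rewrite mem_index_iota => /andP[_ jn].
  rewrite !scoord_spath_of //; last exact: ltnW.
  exact: completed_before_homo.
Qed.

Let cell_gt0 C : C \in p -> (0 < #|C|)%N.
Proof. by move=> Cp; rewrite card_gt0; exact: partition_neq0 part_p Cp. Qed.

Lemma corresponds_spath_of : corresponds (spath_of p) p.
Proof.
apply/and3P; split => //.
- apply/forallP => i; have jn := ltn_ord i.
  rewrite (scoord_spath_of jn) (scoord_spath_of (ltnW jn)).
  case: (boolP [exists C in p, is_cell_max C i]) => [/exists_inP[C Cp Ci]|].
    by rewrite (completed_before_max Cp Ci) -[ltnLHS]addn0 ltn_add2l cell_gt0.
  move=> /exists_inPn h; rewrite completed_before_nomax // ltnn //.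
- apply/forall_inP => C Cp; apply/forallP => i; apply/implyP => Ci.
  have jn := ltn_ord i; rewrite (scoord_spath_of jn) (scoord_spath_of (ltnW jn)).
  by rewrite (completed_before_max Cp Ci) addKn.
Qed.

(** The correspondence prescribes all increments, and [S] starts at 0. *)
Lemma corresponds_scoord S j : is_spath S -> corresponds S p -> (j <= n)%N ->
  scoord S j = completed_before p j.
Proof.
move=> /and4P[/eqP S0 _ _ Smono] /and3P[_ Smax Scard].
elim: j => [|j ih] jn; first by rewrite S0 completed_before0.
pose i := Ordinal jn; have {}ih := ih (ltnW jn).
have /forallP/(_ i)/eqP Si := Smax.
have [/exists_inP[C Cp Ci]|/exists_inPn h] :=
    boolP [exists C in p, is_cell_max C i].
  rewrite (@completed_before_max C i) // -ih.
  have /forall_inP/(_ C Cp)/forallP/(_ i)/implyP/(_ Ci)/eqP -> := Scard.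
  rewrite subnKC // ltnW // -Si.
  by apply/exists_inP; exists C.
rewrite (@completed_before_nomax i) // -ih; apply/eqP.
move: Si; rewrite (negbTE (introN exists_inP _)); last first.
  by move=> [C Cp Ci]; move: (h C Cp); rewrite Ci.
move=> /esym/negbT; rewrite -leqNgt eqn_leq /= => -> /=.
case: (posnP j) => [->|j0]; first by rewrite S0.
by move/allP : Smono; apply; rewrite mem_index_iota j0.
Qed.

Lemma corresponds_unique S : is_spath S -> corresponds S p = (spath_of p == S).
Proof.
move=> pS; apply/idP/eqP => [cS|<-]; last exact: corresponds_spath_of.
apply/ffunP => j; apply: val_inj; have jn : (j <= n)%N by rewrite -ltnS.
have := etrans (scoord_spath_of jn) (esym (corresponds_scoord pS cS jn)).
by rewrite /scoord inord_val.
Qed.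

Definition cell_max C : nat := \max_(i in C) i.

Lemma cell_maxP C (i : 'I_n) : is_cell_max C i -> cell_max C = i.
Proof.
move=> /is_cell_maxP[iC Cmax]; apply/eqP; rewrite eqn_leq /cell_max.
rewrite (leq_bigmax_cond _ iC) andbT; exact/bigmax_leqP.
Qed.

Lemma cell_max_exists C : C \in p -> exists i, is_cell_max C i.
Proof.
move=> Cp; have [i iC mE] := eq_bigmax_cond (fun i : 'I_n => i : nat) (cell_gt0 Cp).
exists i; apply/is_cell_maxP; split => // k kC; rewrite -mE.
exact: leq_bigmax_cond.
Qed.

(** A cell is determined by its maximal element, and these are the positions where
    [S] increases. *)
Lemma perm_cell_max S : corresponds S p ->
  perm_eq [seq cell_max C | C <- enum p]
    [seq j <- iota 0 n | (scoord S j < scoord S j.+1)%N].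
Proof.
move=> /and3P[_ /forallP Smax _]; apply: uniq_perm.
- rewrite map_inj_in_uniq ?enum_uniq // => C D; rewrite !mem_enum => Cp Dp.
  have [i Ci] := cell_max_exists Cp; have [j Dj] := cell_max_exists Dp.
  rewrite (cell_maxP Ci) (cell_maxP Dj) => /val_inj ij.
  have /is_cell_maxP[iC _] := Ci; have /is_cell_maxP[jD _] := Dj.
  by rewrite -(cellE Cp iC) ij (cellE Dp jD).
- by rewrite filter_uniq // iota_uniq.
move=> j; rewrite mem_filter mem_iota add0n /=.
apply/mapP/andP => [[C]|[Sj jn]].
  rewrite mem_enum => Cp ->; have [i Ci] := cell_max_exists Cp.
  rewrite (cell_maxP Ci) ltn_ord; split => //.
  by have /eqP <- := Smax i; apply/exists_inP; exists C.
have /eqP := Smax (Ordinal jn); rewrite /= Sj => /exists_inP[C Cp Ci].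
by exists C; rewrite ?mem_enum // (cell_maxP Ci).
Qed.

Lemma card_cell S C : corresponds S p -> C \in p ->
  #|C| = (scoord S (cell_max C).+1 - scoord S (cell_max C))%N.
Proof.
move=> /and3P[_ _ /forall_inP Scard] Cp; have [i Ci] := cell_max_exists Cp.
by have /forallP/(_ i)/implyP/(_ Ci)/eqP -> := Scard C Cp; rewrite (cell_maxP Ci).
Qed.

Lemma perm_cell_sizes_increments S : corresponds S p ->
  perm_eq (cell_sizes p) (increments 1 n S).
Proof.
move=> cS; rewrite /increments /index_iota subn1 /= (iotaDl 1 0) filter_map -map_comp.
apply: perm_trans (perm_map _ (perm_cell_max cS)).
rewrite -map_comp /cell_sizes.
rewrite (_ : map _ _ = map
  (fun C => scoord S (cell_max C).+1 - scoord S (cell_max C))%N (enum p)).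
  exact: perm_refl.
by apply/eq_in_map => C; rewrite mem_enum => Cp; exact: card_cell.
Qed.

(** A product over cells whose factors depend only on maximal element and size is
    a function of the S-path; the shift by one passes from ordinals to the indices
    1, ..., n. *)
Lemma big_cells_increments (T : Type) (idx : T) (op : Monoid.com_law idx)
    (F : nat -> nat -> T) S : corresponds S p ->
  \big[op/idx]_(C in p) F (cell_max C).+1 #|C| =
  \big[op/idx]_(1 <= j < n.+1 | (scoord S j.-1 < scoord S j)%N)
    F j (scoord S j - scoord S j.-1)%N.
Proof.
move=> cS; rewrite big_add1 /= -[RHS]big_filter /index_iota subn0.
rewrite -(perm_big _ (perm_cell_max cS)) /= big_map big_enum /=.
by apply: eq_bigr => C Cp; rewrite (card_cell cS Cp).
Qed.

End OnePartition.

(** Each partition corresponds to exactly one S-path. *)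
Lemma sum_partitions_spaths (R : nmodType) (F : {set {set 'I_n}} -> R) :
  (\sum_(p : {set {set 'I_n}} | finset.partition p [set: 'I_n]%SET) F p =
   \sum_(S : svec n | is_spath S)
     \sum_(p : {set {set 'I_n}} | corresponds S p) F p)%R.
Proof.
rewrite (partition_big spath_of (@is_spath n)) /=; last first.
  by move=> p; exact: spath_of_is_spath.
apply: eq_bigr => S pS; apply: eq_bigl => p.
have [pp|npp] := boolP (finset.partition p _); first by rewrite corresponds_unique.
by apply/esym/negbTE; apply: contra npp => /and3P[].
Qed.

End SPathOfPartition.

(** * Partitions of a disjoint union *)

Section DisjointSumPartitions.
Variables A B : finType.
Implicit Types (q : {set {set A}}) (r : {set {set B}}) (p : {set {set A + B}}).

Definition join_partitions q r : {set {set A + B}} :=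
  (push_partition inl q :|: push_partition inr r)%SET.

Definition mixed (C : {set A + B}) : bool :=
  [exists a, exists b, (inl a \in C) && (inr b \in C)].

Let inl_inj : injective (@inl A B). Proof. by move=> x y []. Qed.
Let inr_inj : injective (@inr A B). Proof. by move=> x y []. Qed.

Lemma in_join_partitions q r C :
  reflect ((exists2 D, D \in q & C = inl @: D) \/
           (exists2 D, D \in r & C = inr @: D))
    (C \in join_partitions q r).
Proof.
rewrite !inE; apply: (iffP orP) => -[h|h]; [left|right|left|right];
  exact/imsetP.
Qed.

Let mem_inl (D : {set A}) a : (inl a \in (inl @: D : {set A + B})) = (a \in D).
Proof. exact: mem_imset. Qed.
Let mem_inr (D : {set B}) b : (inr b \in (inr @: D : {set A + B})) = (b \in D).
Proof. exact: mem_imset. Qed.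
Let inlNinr (D : {set B}) a : (inl a \in (inr @: D : {set A + B})) = false.
Proof. by apply/imsetP => -[]. Qed.
Let inrNinl (D : {set A}) b : (inr b \in (inl @: D : {set A + B})) = false.
Proof. by apply/imsetP => -[]. Qed.

Let disjoint_lr (C : {set A}) (D : {set B}) :
  disjoint (mem (inl @: C : {set A + B})) (mem (inr @: D : {set A + B})).
Proof.
rewrite -finset.setI_eq0; apply/eqP/setP => -[x|x]; rewrite !inE.
  by rewrite inlNinr andbF.
by rewrite inrNinl.
Qed.

Lemma partition_join q r :
  finset.partition (join_partitions q r) [set: A + B]%SET =
  finset.partition q [set: A]%SET && finset.partition r [set: B]%SET.
Proof.
apply/idP/andP => [/and3P[/eqP cov tri no0]|[]].
  have inj C : C \in q -> inl @: C \in join_partitions q r.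
    by move=> Cq; apply/in_join_partitions; left; exists C.
  have inj' C : C \in r -> inr @: C \in join_partitions q r.
    by move=> Cq; apply/in_join_partitions; right; exists C.
  split; apply/and3P; split.
  - apply/eqP/setP => a; rewrite inE.
    have : inl a \in finset.cover (join_partitions q r) by rewrite cov inE.
    move=> /finset.bigcupP[_ /in_join_partitions[[D Dq ->]|[D Dr ->]]].
      by rewrite mem_inl => aD; apply/finset.bigcupP; exists D.
    by rewrite inlNinr.
  - apply/finset.trivIsetP => C D Cq Dq CD.
    rewrite -(imset_disjoint inl_inj).
    by apply: (finset.trivIsetP tri); rewrite ?inj ?(inj_eq (imset_inj inl_inj)).
  - by apply: contra no0 => /inj; rewrite imset0.
  - apply/eqP/setP => a; rewrite inE.
    have : inr a \in finset.cover (join_partitions q r) by rewrite cov inE.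
    move=> /finset.bigcupP[_ /in_join_partitions[[D Dq ->]|[D Dr ->]]].
      by rewrite inrNinl.
    by rewrite mem_inr => aD; apply/finset.bigcupP; exists D.
  - apply/finset.trivIsetP => C D Cq Dq CD.
    rewrite -(imset_disjoint inr_inj).
    by apply: (finset.trivIsetP tri); rewrite ?inj' ?(inj_eq (imset_inj inr_inj)).
  - by apply: contra no0 => /inj'; rewrite imset0.
move=> /and3P[/eqP covq triq q0] /and3P[/eqP covr trir r0].
apply/and3P; split.
- apply/eqP/setP => -[a|b]; rewrite inE.
    have : a \in finset.cover q by rewrite covq inE.
    move=> /finset.bigcupP[C Cq aC]; apply/finset.bigcupP; exists (inl @: C)%SET.
      by apply/in_join_partitions; left; exists C.
    by rewrite mem_inl.
  have : b \in finset.cover r by rewrite covr inE.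
  move=> /finset.bigcupP[C Cr bC]; apply/finset.bigcupP; exists (inr @: C)%SET.
    by apply/in_join_partitions; right; exists C.
  by rewrite mem_inr.
- apply/finset.trivIsetP => _ _ /in_join_partitions[[C Cq ->]|[C Cr ->]]
    /in_join_partitions[[D Dq ->]|[D Dr ->]] CD.
  + rewrite imset_disjoint //; apply: (finset.trivIsetP triq) => //.
    by apply: contraNneq CD => ->.
  + exact: disjoint_lr.
  + by rewrite disjoint_sym; exact: disjoint_lr.
  + rewrite imset_disjoint //; apply: (finset.trivIsetP trir) => //.
    by apply: contraNneq CD => ->.
- apply/negP => /in_join_partitions[[C Cq /esym/eqP]|[C Cr /esym/eqP]];
    rewrite imset_eq0 => /eqP C0; rewrite C0 in Cq || rewrite C0 in Cr.
    by rewrite Cq in q0.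
  by rewrite Cr in r0.
Qed.

Lemma join_partitions_disjoint q r : finset.partition r [set: B]%SET ->
  disjoint (mem (push_partition inl q)) (mem (push_partition (@inr A B) r)).
Proof.
move=> /and3P[_ _ r0]; rewrite -finset.setI_eq0; apply/eqP/setP => C.
rewrite !inE; apply/negP => /andP[/imsetP[D Dq ->] /imsetP[E Er DE]].
have E0 : E = finset.set0.
  apply/setP => b; rewrite inE; apply/negP => bE.
  by have := inrNinl D b; rewrite DE mem_inr bE.
by rewrite E0 in Er; rewrite Er in r0.
Qed.

Lemma big_join_partitions (T : Type) (idx : T) (op : Monoid.com_law idx)
    (F : {set A + B} -> T) q r : finset.partition r [set: B]%SET ->
  \big[op/idx]_(C in join_partitions q r) F C =
  op (\big[op/idx]_(C in q) F (inl @: C)%SET)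
     (\big[op/idx]_(C in r) F (inr @: C)%SET).
Proof.
move=> pr; rewrite -!big_push_partition // -bigU /=; last first.
  exact: join_partitions_disjoint.
by apply: eq_bigl => C; rewrite !inE.
Qed.

Lemma perm_cell_sizes_join q r : finset.partition r [set: B]%SET ->
  perm_eq (cell_sizes (join_partitions q r)) (cell_sizes q ++ cell_sizes r).
Proof.
move=> pr; have : perm_eq (enum (join_partitions q r))
    (enum (push_partition inl q) ++ enum (push_partition (@inr A B) r)).
  apply: uniq_perm.
  - exact: enum_uniq.
  - rewrite cat_uniq !enum_uniq /= andbT; apply/hasPn => C; rewrite !mem_enum => Cr.
    have := join_partitions_disjoint q pr; rewrite disjoint_sym.
    by move=> /disjointFr/(_ Cr) ->.
  - by move=> C; rewrite mem_cat !mem_enum !inE.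
move=> /(perm_map (fun C : {set A + B} => #|C|)); rewrite map_cat => /perm_trans.
by apply; apply: perm_cat; exact: perm_cell_sizes_push.
Qed.

(** A partition without mixed block is the union of its traces on the two
    summands. *)
Lemma sum_partitions_disjoint_sum (R : nmodType) (F : {set {set A + B}} -> R) :
  (forall p C, finset.partition p [set: A + B]%SET -> C \in p -> mixed C ->
     F p = 0) ->
  \sum_(p : {set {set A + B}} | finset.partition p [set: A + B]%SET) F p =
  \sum_(q : {set {set A}} | finset.partition q [set: A]%SET)
    \sum_(r : {set {set B}} | finset.partition r [set: B]%SET)
      F (join_partitions q r).
Proof.
move=> F0; pose pure p := [forall C in p, ~~ mixed C].
pose split_p p : {set {set A}} * {set {set B}} :=
  ([set C : {set A} | inl @: C \in p]%SET, [set C : {set B} | inr @: C \in p]%SET).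
rewrite (bigID pure) /= [X in _ + X]big1 ?addr0; last first.
  by move=> p /andP[pp /forall_inPn[C Cp]]; rewrite negbK => /(F0 p C pp Cp).
rewrite pair_big /=.
rewrite (reindex_onto (fun qr : _ * _ => join_partitions qr.1 qr.2) split_p) /=.
  apply: eq_bigl => -[q r] /=; rewrite partition_join.
  have [/= pq|] := boolP (finset.partition q _) => //=.
  have [/= pr|] := boolP (finset.partition r _) => //=.
  apply/andP; split.
    apply/forall_inP => C /in_join_partitions[[D Dq ->]|[D Dr ->]];
      apply/existsPn => a; apply/existsPn => b; rewrite ?inrNinl ?inlNinr ?andbF //.
  have /and3P[_ _ q0] := pq; have /and3P[_ _ r0] := pr.
  apply/eqP; congr pair; apply/setP => C; rewrite inE;
    apply/in_join_partitions/idP => [|Cin].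
  - case=> -[D Din]; first by move/(imset_inj inl_inj) ->.
    move=> CD; suff D0 : D = finset.set0 by rewrite D0 (negbTE r0) in Din.
    apply/setP => b; rewrite inE; apply/negP => bE.
    by have := inrNinl C b; rewrite CD mem_inr bE.
  - by left; exists C.
  - case=> -[D Din]; last by move/(imset_inj inr_inj) ->.
    move=> CD; suff D0 : D = finset.set0 by rewrite D0 (negbTE q0) in Din.
    apply/setP => b; rewrite inE; apply/negP => bE.
    by have := inlNinr C b; rewrite CD mem_inl bE.
  - by right; exists C.
move=> p /andP[/and3P[_ _ p0] /forall_inP pure_p]; apply/setP => C.
apply/in_join_partitions/idP => [[[D + ->]|[D + ->]]|Cp]; rewrite ?inE //.
have /finset.set0Pn[x xC] : C != finset.set0.
  by apply: contraNneq p0 => <-.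
have := pure_p C Cp => /existsPn hC.
case: x xC => [a aC|b bC].
  have CE : C = inl @: (inl @^-1: C)%SET.
    apply/setP => -[x|x]; first by rewrite mem_inl inE.
    rewrite inrNinl; apply/negP => xC.
    by have /existsPn/(_ x) := hC a; rewrite aC xC.
  by left; exists (inl @^-1: C)%SET; rewrite ?inE -?CE.
have CE : C = inr @: (inr @^-1: C)%SET.
  apply/setP => -[x|x]; last by rewrite mem_inr inE.
  rewrite inlNinr; apply/negP => xC.
  by have /existsPn/(_ b) := hC x; rewrite bC xC.
by right; exists (inr @^-1: C)%SET; rewrite ?inE -?CE.
Qed.

End DisjointSumPartitions.

(** * Averaging over G with theta fixed *)

Section IndependentIntegral.
Context d (Omega : measurableType d) (R : realType) (P : probability Omega R).
Context (theta : {RV P >-> R}) (prior : probability R R).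
Hypothesis hprior : forall A : set R, measurable A -> P (theta @^-1` A) = prior A.
Local Open Scope ereal_scope.

Section Systems.
Variable Sys : set (set Omega).
Hypothesis Sys_measurable : Sys `<=` measurable.
Hypothesis Sys_indep : forall A B, measurable A -> <<s Sys >> B ->
  P (theta @^-1` A `&` B) = P (theta @^-1` A) * P B.

(* The sample space with the coarser sigma-algebra generated by [Sys].  For this
   structure independence says that the joint law of theta and of the sample
   point itself is a product measure, to which the Tonelli theorem applies. *)
Let OmegaS := g_sigma_algebraType Sys.

Let forget : Omega -> OmegaS := id.

Let measurable_forget : measurable_fun setT forget.
Proof.
move=> _ A mA; rewrite setTI /forget preimage_id.
exact: (smallest_sub (@sigma_algebra_measurable _ Omega) Sys_measurable) mA.
Qed.

HB.instance Definition _ :=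
  @isMeasurableFun.Build _ _ _ _ forget measurable_forget.

Let PS : probability OmegaS R := distribution P forget.

Let pairing (w : Omega) : R * OmegaS := (theta w, forget w).

Let measurable_pairing : measurable_fun setT pairing.
Proof. by apply: measurable_fun_pair. Qed.

HB.instance Definition _ :=
  @isMeasurableFun.Build _ _ _ _ pairing measurable_pairing.

Let joint_law A : measurable A ->
  (prior \x PS) A = distribution P pairing A.
Proof.
apply: product_measure_unique => {}A B mA mB.
have := Sys_indep mA mB; rewrite (hprior mA); exact.
Qed.

(** Freezing: a function of theta and of a point seen only through [Sys] is
    averaged in two stages. *)
Lemma independent_integral (h : R * OmegaS -> \bar R) (B : set R) :
  measurable_fun setT h -> (forall z, 0 <= h z) -> measurable B ->
  measurable_fun setT (fun th => \int[P]_w h (th, w)) /\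
  \int[P]_(w in theta @^-1` B) h (theta w, w) =
  \int[prior]_(th in B) \int[P]_w h (th, w).
Proof.
move=> mh h0 mB.
have hP th : \int[P]_w h (th, w) = \int[PS]_w h (th, w).
  rewrite ge0_integral_distribution //.
  by apply: measurableT_comp => //; exact: measurable_pair1.
split.
  under eq_fun do rewrite hP.
  exact: measurable_fun_fubini_tonelli_F.
under [RHS]eq_integral do rewrite hP.
have mBT : measurable (B `*` [set: OmegaS]) by exact: measurableX.
transitivity (\int[distribution P pairing]_(z in B `*` [set: OmegaS]) h z).
  rewrite ge0_integral_pushforward //; last exact: measurable_funTS.
  congr (integral _ _ _); apply/seteqP; split => w //=.
  by case.
rewrite (eq_measure_integral (prior \x PS)); last first.
  by move=> A mA _; exact: (esym (joint_law mA)).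
rewrite integral_mkcond fubini_tonelli1 //; last 2 first.
- exact/(measurable_restrictT _ _).1/measurable_funTS.
- by move=> z; exact: erestrict_ge0.
rewrite [RHS]integral_mkcond; apply: eq_integral => th _.
rewrite /fubini_F patchE; case: ifPn => thB.
  apply: eq_integral => w _; rewrite patchE ifT //.
  by move: thB; rewrite !inE.
apply: integral0_eq => w _; rewrite patchE ifF //.
apply/negbTE; apply: contra thB; rewrite !inE.
by case.
Qed.

End Systems.
End IndependentIntegral.

(** * The mixture kernel and the likelihood *)

Section MixKernel.
Context (R : realType).
Implicit Types u x : R.

Lemma mix_kernel_pos u x : 0 < u ->
  mix_kernel u x = x^-1 * (u <= x)%R%:R.
Proof.
move=> u0; rewrite /mix_kernel u0 /= [u < 0]ltNge (ltW u0) andbF subr0.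
by [].
Qed.

Lemma mix_kernel_neg u x : u < 0 ->
  mix_kernel u x = (- x)^-1 * (x <= u)%R%:R.
Proof.
move=> u0; rewrite /mix_kernel u0 andbT [0 < u]ltNge (ltW u0) /= sub0r.
by rewrite invrN mulrN mulNr.
Qed.

Lemma mix_kernel0 x : mix_kernel 0 x = 0 :> R.
Proof. by rewrite /mix_kernel ltxx /= andbF subr0 mulr0. Qed.

Lemma mix_kernel_bounds u x : 0 <= mix_kernel u x <= `|u|^-1.
Proof.
have [u0|u0|<-] := ltgtP 0 u; last by rewrite mix_kernel0 normr0 invr0 lexx.
- rewrite mix_kernel_pos // gtr0_norm //; case: (leP u x) => ux; last first.
    by rewrite /= ?mulr0n mulr0 lexx invr_ge0 ltW.
  have x0 := lt_le_trans u0 ux.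
  by rewrite /= ?mulr1n mulr1 invr_ge0 (ltW x0) lef_pV2 // posrE.
- rewrite mix_kernel_neg // ltr0_norm //; case: (leP x u) => ux; last first.
    by rewrite /= ?mulr0n mulr0 lexx invr_ge0 oppr_ge0 ltW.
  have x0 := le_lt_trans ux u0.
  rewrite /= ?mulr1n mulr1 invr_ge0 oppr_ge0 (ltW x0) lef_pV2 ?posrE ?oppr_gt0 //.
  by rewrite lerN2.
Qed.

Lemma measurable_inv : measurable_fun [set: R] (fun x => x^-1).
Proof.
have -> : [set: R] = [set x | x != 0] `|` [set 0].
  by apply/seteqP; split => x // _; have [->|] := eqVneq x 0; [right|left].
have mN0 : open [set x : R | x != 0] by exact: open_neq.
have mN0' : measurable [set x : R | x != 0] by exact: open_measurable.
apply/measurable_funU => //; split; last exact: measurable_fun_set1.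
apply: open_continuous_measurable_fun => // x; rewrite inE => x0.
exact: inv_continuous.
Qed.

Lemma measurable_bool_natr d (T : measurableType d) (b : T -> bool) :
  measurable_fun setT b -> measurable_fun setT (fun z => (b z)%:R : R).
Proof.
by move=> mb; apply: (@measurableT_comp _ _ _ _ _ _ (fun c : bool => c%:R : R)).
Qed.

Lemma measurable_mix_kernel d (T : measurableType d) (u x : T -> R) :
  measurable_fun setT u -> measurable_fun setT x ->
  measurable_fun setT (fun z => mix_kernel (u z) (x z)).
Proof.
move=> mu mx; apply: measurable_funM.
  by apply: measurableT_comp mx; exact: measurable_inv.
apply: measurable_funB; apply: measurable_bool_natr; apply: measurable_and.
- exact: measurable_fun_ltr.
- exact: measurable_fun_ler.
- exact: measurable_fun_ler.
- exact: measurable_fun_ltr.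
Qed.

Lemma bounded_nonneg_mix_kernel u :
  bounded_nonneg (fun x => (mix_kernel u x)%:E).
Proof.
split; first split.
- by apply/measurable_EFinP; apply: measurable_mix_kernel.
- by move=> x; rewrite lee_fin; have /andP[] := mix_kernel_bounds u x.
by exists `|u|^-1 => x; rewrite lee_fin; have /andP[] := mix_kernel_bounds u x.
Qed.

End MixKernel.

Section JointLikelihood.
Context d (Omega : measurableType d) (R : realType) (G : R.-pker Omega ~> R).
Local Open Scope ereal_scope.

Definition kernel_events : set (set Omega) :=
  \bigcup_(A in (measurable : set (set R)))
    preimage_set_system setT (fun w => G w A) measurable.

Lemma kernel_events_measurable : kernel_events `<=` measurable.
Proof.
move=> _ [A mA [B mB <-]]; exact: measurable_kernel.
Qed.

Let OmegaG := g_sigma_algebraType kernel_events.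

Let G2 (z : R * OmegaG) : {measure set R -> \bar R} := G z.2.

Let measurable_G2 U : measurable U -> measurable_fun setT (G2 ^~ U).
Proof.
move=> mU; apply: (@measurableT_comp _ _ _ _ _ _ (fun w : OmegaG => G w U)).
  by move=> _ B mB; apply: sub_sigma_algebra; exists U => //; exists B.
exact: measurable_snd.
Qed.

HB.instance Definition _ := isKernel.Build _ _ _ _ R G2 measurable_G2.

Let G2_prob z : G2 z setT = 1.
Proof. exact: prob_kernel. Qed.

HB.instance Definition _ := Kernel_isProbability.Build _ _ _ _ R G2 G2_prob.

(** Joint measurability for the sigma-algebra generated by the variables [G A]:
    [G] remains a kernel on the coarser space, viewed as a kernel on pairs
    (theta, sample point) that ignores theta. *)
Lemma measurable_joint_likelihood (T : seq R) :
  measurable_fun setT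
    (fun z : R * OmegaG => \prod_(t <- T) density (G z.2) z.1 t).
Proof.
apply: emeasurable_prod => t _.
apply: (@measurable_fun_integral_finite_kernel _ _ _ _ _
  (fun y : (R * OmegaG) * R => (mix_kernel (t - y.1.1) y.2)%:E) G2).
- by move=> y; rewrite lee_fin; have /andP[] := mix_kernel_bounds (t - y.1.1) y.2.
apply/measurable_EFinP; apply: measurable_mix_kernel; last exact: measurable_snd.
apply: measurable_funB => //.
by apply: measurableT_comp => //; exact: measurable_fst.
Qed.

Lemma joint_likelihood_ge0 (T : seq R) (z : R * OmegaG) :
  0 <= \prod_(t <- T) density (G z.2) z.1 t.
Proof.
apply: prode_ge0 => t _; apply: integral_ge0 => x _; rewrite lee_fin.
by have /andP[] := mix_kernel_bounds (t - z.1) x.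
Qed.

End JointLikelihood.

Section Bayes.
Context d (Omega : measurableType d) (R : realType) (P : probability Omega R).
Context (G : R.-pker Omega ~> R) (theta : {RV P >-> R}) (prior : probability R R).
Hypothesis hprior : forall A : set R, measurable A -> P (theta @^-1` A) = prior A.
Hypothesis hindep : independent_of_G theta G.
Local Open Scope ereal_scope.

Definition expected_likelihood (T : seq R) (th : R) : \bar R :=
  \int[P]_w \prod_(t <- T) density (G w) th t.

Let Sys_indep A B : measurable A -> <<s kernel_events G >> B ->
  P (theta @^-1` A `&` B) = P (theta @^-1` A) * P B.
Proof.
move=> mA sB; apply: hindep => //.
apply: sub_sigma_algebra; exists tt => //; exists A => //.
by rewrite setTI.
Qed.

Lemma measurable_expected_likelihood T :
  measurable_fun setT (expected_likelihood T).
Proof.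
have [|h _] := independent_integral hprior (@kernel_events_measurable _ _ _ G)
  Sys_indep (@measurable_joint_likelihood _ _ _ G T) _ measurableT; last exact: h.
exact: joint_likelihood_ge0.
Qed.

Lemma expected_likelihood_ge0 T th : 0 <= expected_likelihood T th.
Proof.
by apply: integral_ge0 => w _; exact: (joint_likelihood_ge0 T (th, w)).
Qed.

Lemma integral_likelihood T B : measurable B ->
  \int[P]_(w in theta @^-1` B) likelihood G theta T w =
  \int[prior]_(th in B) expected_likelihood T th.
Proof.
move=> mB.
have [|_ h] := independent_integral hprior (@kernel_events_measurable _ _ _ G)
  Sys_indep (@measurable_joint_likelihood _ _ _ G T) _ mB; last exact: h.
exact: joint_likelihood_ge0.
Qed.

End Bayes.

(** * Contribution of one block *)

Section BlockIntegrals.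
Context (R : realType) (H : probability R R) (n : nat) (y : nat -> R).

Let HT : H setT = 1%E. Proof. exact: probability_setT. Qed.

Let integral_fine (f : R -> R) : bounded_nonneg (fun x => (f x)%:E) ->
  (\int[H]_x (f x)%:E)%E = (\int[H]_x f x)%:E.
Proof.
by move=> bf; have [M _ hM] := integral_bounded_nonneg HT bf; rewrite /Rintegral hM.
Qed.

Let bounded_prod (D : {set 'I_n}) :
  bounded_nonneg (fun x => (\prod_(i in D) mix_kernel (y i.+1) x)%:E).
Proof.
rewrite (_ : (fun _ => _) = fun x => \prod_(i in D) (mix_kernel (y i.+1) x)%:E)%E.
  by apply: bounded_nonneg_prod => i _; exact: bounded_nonneg_mix_kernel.
by apply/funext => x; rewrite prodEFin.
Qed.

(** The product of the indicators I(y_j <= x) over the block is the indicator for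
    the largest y_j, the one with the maximal index. *)
Lemma integral_block_pos (D : {set 'I_n}) (i : 'I_n) :
  (forall j, (j < n)%N -> 0 < y j.+1) ->
  (forall j k, (j <= k)%N -> (k < n)%N -> y j.+1 <= y k.+1) ->
  is_cell_max D i ->
  (\int[H]_x \prod_(j in D) (mix_kernel (y j.+1) x)%:E =
   (\int[H]_(u in `[y i.+1, +oo[) u ^- #|D|)%:E)%E.
Proof.
move=> y0 ymono /is_cell_maxP[iD Dmax].
under eq_integral do rewrite prodEFin.
rewrite (integral_fine (bounded_prod D)) [in RHS]Rintegral_mkcond; congr (_%:E).
apply: eq_Rintegral => x _; rewrite patchE.
have [yx|yx] := boolP (y i.+1 <= x).
  rewrite mem_set /=; last by rewrite in_itv /= andbT.
  rewrite (eq_bigr (fun _ => x^-1)); first by rewrite prodr_const exprVn.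
  move=> j jD; rewrite mix_kernel_pos ?y0 // (le_trans _ yx) ?mulr1 //.
  exact: ymono (Dmax j jD) _.
rewrite memNset /=; last by rewrite in_itv /= andbT; exact/negP.
by rewrite (bigD1 i) //= mix_kernel_pos ?y0 // (negbTE yx) mulr0 mul0r.
Qed.

(** Here y is decreasing, so that the maximal index again gives the binding
    constraint x <= y_j. *)
Lemma integral_block_neg (D : {set 'I_n}) (i : 'I_n) :
  (forall j, (j < n)%N -> y j.+1 < 0) ->
  (forall j k, (j <= k)%N -> (k < n)%N -> y k.+1 <= y j.+1) ->
  is_cell_max D i ->
  (\int[H]_x \prod_(j in D) (mix_kernel (y j.+1) x)%:E =
   (\int[H]_(v in `]-oo, y i.+1]) (- v) ^- #|D|)%:E)%E.
Proof.
move=> y0 ymono /is_cell_maxP[iD Dmax].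
under eq_integral do rewrite prodEFin.
rewrite (integral_fine (bounded_prod D)) [in RHS]Rintegral_mkcond; congr (_%:E).
apply: eq_Rintegral => x _; rewrite patchE.
have [yx|yx] := boolP (x <= y i.+1).
  rewrite mem_set /=; last by rewrite in_itv.
  rewrite (eq_bigr (fun _ => (- x)^-1)); first by rewrite prodr_const exprVn.
  move=> j jD; rewrite mix_kernel_neg ?y0 // (le_trans yx) ?mulr1 //.
  exact: ymono (Dmax j jD) _.
rewrite memNset /=; last by rewrite in_itv; exact/negP.
by rewrite (bigD1 i) //= mix_kernel_neg ?y0 // (negbTE yx) mulr0 mul0r.
Qed.

End BlockIntegrals.

(** * Observations sorted by their distance to theta *)

Section SortedObservations.
Context (R : realType) (th : R) (T : seq R).

Let ys := sort <=%R [seq t - th | t <- T & th < t].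
Let zs := sort >=%R [seq t - th | t <- T & t < th].

Let mem_ys u : u \in ys -> 0 < u.
Proof.
rewrite mem_sort => /mapP[t]; rewrite mem_filter => /andP[tht _] ->.
by rewrite subr_gt0.
Qed.

Let mem_zs u : u \in zs -> u < 0.
Proof.
rewrite mem_sort => /mapP[t]; rewrite mem_filter => /andP[tht _] ->.
by rewrite subr_lt0.
Qed.

Let size_ys : size ys = n_above th T.
Proof. by rewrite size_sort size_map size_filter. Qed.

Hypothesis thT : th \notin T.

Lemma size_below : size zs = (size T - n_above th T)%N.
Proof.
rewrite size_sort size_map size_filter /n_above -(count_predC (fun t => th < t) T).
rewrite addKn; apply: eq_in_count => t tT /=; rewrite -leNgt lt_neqAle.
by rewrite (memPn thT).
Qed.

Lemma Yseq_gt0 j : (j < n_above th T)%N -> 0 < Yseq th T j.+1.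
Proof. by move=> jn; apply: mem_ys; rewrite mem_nth // size_ys. Qed.

Lemma Zseq_lt0 j : (j < size T - n_above th T)%N -> Zseq th T j.+1 < 0.
Proof. by move=> jn; apply: mem_zs; rewrite mem_nth // size_below. Qed.

Lemma Yseq_homo j k : (j <= k)%N -> (k < n_above th T)%N ->
  Yseq th T j.+1 <= Yseq th T k.+1.
Proof.
move=> jk kn; apply: (sorted_leq_nth le_trans le_refl) => //.
- by apply: sort_sorted; exact: le_total.
- by rewrite inE -/ys size_ys (leq_ltn_trans jk).
- by rewrite inE -/ys size_ys.
Qed.

Lemma Zseq_homo j k : (j <= k)%N -> (k < size T - n_above th T)%N ->
  Zseq th T k.+1 <= Zseq th T j.+1.
Proof.
move=> jk kn; apply: (@sorted_leq_nth _ >=%R ge_trans ge_refl) => //.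
- by apply: sort_sorted; exact: ge_total.
- by rewrite inE -/zs size_below (leq_ltn_trans jk).
- by rewrite inE -/zs size_below.
Qed.

Lemma big_observations (S : Type) (idx : S) (op : Monoid.com_law idx)
    (F : R -> S) :
  \big[op/idx]_(t <- T) F (t - th) =
  op (\big[op/idx]_(i < n_above th T) F (Yseq th T i.+1))
     (\big[op/idx]_(i < size T - n_above th T) F (Zseq th T i.+1)).
Proof.
rewrite (bigID (fun t => th < t)) /=; congr (op _ _).
- rewrite -big_filter -(big_map (fun t => t - th) xpredT F).
  rewrite (perm_big ys) /=; last by rewrite perm_sym perm_sort.
  by rewrite (big_nth 0) size_ys big_mkord.
- rewrite big_seq_cond (eq_bigl (fun t => (t \in T) && (t < th))); last first.
    move=> t /=; case: (boolP (t \in T)) => //= tT.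
    by rewrite -leNgt lt_neqAle (memPn thT).
  rewrite -big_seq_cond -big_filter -(big_map (fun t => t - th) xpredT F).
  rewrite (perm_big zs) /=; last by rewrite perm_sym perm_sort.
  by rewrite (big_nth 0) size_below big_mkord.
Qed.

End SortedObservations.

(** * The averaged likelihood as a sum over pairs of S-paths *)

Lemma increments_gt0 n (S : svec n) a b : all (leq 1) (increments a b S).
Proof.
rewrite all_map; apply/allP => j; rewrite mem_filter => /andP[jS _] /=.
by rewrite subn_gt0.
Qed.

Section FixedTheta.
Context d (Omega : measurableType d) (R : realType) (P : probability Omega R).
Context (H : probability R R) (G : R.-pker Omega ~> R) (chi : seq nat -> R).
Hypothesis H_nonatomic : forall x : R, H [set x] = 0%E.
Hypothesis hchi : is_eppf P H G chi.
Context (th : R) (T : seq R).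

Let n := n_above th T.
Let m := (size T - n)%N.

Let offset (j : 'I_n + 'I_m) : R :=
  match j with inl i => Yseq th T i.+1 | inr i => Zseq th T i.+1 end.

Let block_integral (C : {set 'I_n + 'I_m}) : R :=
  fine (\int[H]_x \prod_(j in C) (mix_kernel (offset j) x)%:E).

Let block_integralE (C : {set 'I_n + 'I_m}) :
  (\int[H]_x \prod_(j in C) (mix_kernel (offset j) x)%:E)%E =
  (block_integral C)%:E.
Proof.
have HT : H setT = 1%E by exact: probability_setT.
have [|M _ e] := @integral_bounded_nonneg _ _ _ H
    (fun x => \prod_(j in C) (mix_kernel (offset j) x)%:E)%E HT.
  by apply: bounded_nonneg_prod => j _; exact: bounded_nonneg_mix_kernel.
by rewrite /block_integral e.
Qed.

Hypothesis thT : th \notin T.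

Let expected_likelihood_partitions :
  expected_likelihood P G T th =
  (\sum_(p : {set {set 'I_n + 'I_m}} |
      finset.partition p [set: 'I_n + 'I_m]%SET)
     chi (cell_sizes p) * \prod_(C in p) block_integral C)%:E.
Proof.
transitivity (\int[P]_w \prod_(j : 'I_n + 'I_m)
    \int[G w]_x (mix_kernel (offset j) x)%:E)%E.
  apply: eq_integral => w _; rewrite big_sumType /=.
  exact: (big_observations thT _ (fun u => \int[G w]_x (mix_kernel u x)%:E)%E).
rewrite (eppf_functions H_nonatomic hchi); last first.
  by move=> j; exact: bounded_nonneg_mix_kernel.
rewrite -sumEFin; apply: eq_bigr => p _; rewrite EFinM -prodEFin.
by congr (_ * _)%E; apply: eq_bigr => C _; exact: block_integralE.
Qed.

(* The kernels on the two sides of theta have disjoint supports. *)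
Let block_integral_mixed (C : {set 'I_n + 'I_m}) : mixed C -> block_integral C = 0.
Proof.
move=> /existsP[a /existsP[b /andP[aC bC]]]; rewrite /block_integral.
rewrite integral0_eq // => x _; rewrite prodEFin; congr (_%:E).
have Ya := Yseq_gt0 (ltn_ord a); have Zb := Zseq_lt0 thT (ltn_ord b).
have [xY|xY] := leP (Yseq th T a.+1) x.
  rewrite (bigD1 (inr b)) //= mix_kernel_neg // [x <= _]leNgt.
  by rewrite (lt_trans Zb) ?mulr0 ?mul0r // (lt_le_trans Ya).
by rewrite (bigD1 (inl a)) //= mix_kernel_pos // leNgt xY mulr0 mul0r.
Qed.

Let prod_blocks_pos (q : {set {set 'I_n}}) (S : svec n) :
  corresponds S q ->
  \prod_(C in q) block_integral (inl @: C)%SET =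
  \prod_(1 <= j < n.+1 | (scoord S j.-1 < scoord S j)%N)
    \int[H]_(u in `[Yseq th T j, +oo[) u ^- (scoord S j - scoord S j.-1).
Proof.
move=> cS; have /and3P[pq _ _] := cS.
rewrite -(big_cells_increments pq _
  (fun j k => \int[H]_(u in `[Yseq th T j, +oo[) u ^- k)%R cS).
apply: eq_bigr => C Cq; have [i Ci] := cell_max_exists pq Cq.
rewrite (cell_maxP Ci) /block_integral.
under eq_integral => x _.
  rewrite big_imset /=; last by move=> ? ? _ _ [].
  over.
rewrite (integral_block_pos H _ _ Ci) //.
- exact: Yseq_gt0.
- exact: Yseq_homo.
Qed.

Let prod_blocks_neg (r : {set {set 'I_m}}) (S : svec m) :
  corresponds S r ->
  \prod_(C in r) block_integral (inr @: C)%SET =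
  \prod_(1 <= j < m.+1 | (scoord S j.-1 < scoord S j)%N)
    \int[H]_(v in `]-oo, Zseq th T j]) (- v) ^- (scoord S j - scoord S j.-1).
Proof.
move=> cS; have /and3P[pr _ _] := cS.
rewrite -(big_cells_increments pr _
  (fun j k => \int[H]_(v in `]-oo, Zseq th T j]) (- v) ^- k)%R cS).
apply: eq_bigr => C Cr; have [i Ci] := cell_max_exists pr Cr.
rewrite (cell_maxP Ci) /block_integral.
under eq_integral => x _.
  rewrite big_imset /=; last by move=> ? ? _ _ [].
  over.
rewrite (integral_block_neg H _ _ Ci) //.
- by move=> j jm; exact: Zseq_lt0.
- by move=> j k jk km; exact: Zseq_homo.
Qed.

(** Partitions are split into their parts above and below [th], each part is
    replaced by its S-path, and the terms with equal S-paths are counted. *)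
Lemma expected_likelihood_spaths :
  expected_likelihood P G T th =
  (\sum_(Sp : svec n | is_spath Sp) \sum_(Sm : svec m | is_spath Sm)
     phi_prod H chi th T Sm Sp)%:E.
Proof.
rewrite expected_likelihood_partitions; congr (_%:E).
rewrite sum_partitions_disjoint_sum; last first.
  by move=> p C _ Cp mC; rewrite (bigD1 C) //= block_integral_mixed // mul0r mulr0.
rewrite sum_partitions_spaths; apply: eq_bigr => Sp pSp.
under eq_bigr do rewrite sum_partitions_spaths.
rewrite exchange_big /=; apply: eq_bigr => Sm pSm.
pose c : R := chi (increments 1 n Sp ++ increments 1 m Sm).
set A := (\prod_(1 <= j < n.+1 | (scoord Sp j.-1 < scoord Sp j)%N)
  \int[H]_(u in `[Yseq th T j, +oo[) u ^- (scoord Sp j - scoord Sp j.-1)).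
set B := (\prod_(1 <= j < m.+1 | (scoord Sm j.-1 < scoord Sm j)%N)
  \int[H]_(v in `]-oo, Zseq th T j]) (- v) ^- (scoord Sm j - scoord Sm j.-1)).
transitivity (\sum_(q : {set {set 'I_n}} | corresponds Sp q)
    \sum_(r : {set {set 'I_m}} | corresponds Sm r) (c * (A * B))).
  apply: eq_bigr => q cq; apply: eq_bigr => r cr.
  have /and3P[pq _ _] := cq; have /and3P[pr _ _] := cr.
  rewrite big_join_partitions // (prod_blocks_pos cq) (prod_blocks_neg cr).
  congr (_ * _); have [_ hsym _] := hchi; apply: hsym.
    by apply: cell_sizes_gt0; rewrite partition_join pq pr.
  apply: perm_trans (perm_cell_sizes_join q pr) _.
  by apply: perm_cat; exact: perm_cell_sizes_increments.
rewrite !sumr_const -/n -/m.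
have -> : #|(fun q : {set {set 'I_n}} => corresponds Sp q)| = card_CS Sp.
  by rewrite /card_CS cardsE.
have -> : #|(fun r : {set {set 'I_m}} => corresponds Sm r)| = card_CS Sm.
  by rewrite /card_CS cardsE.
rewrite /phi_prod (negbTE thT) /phi_plus /phi_minus -/A -/B -/c.
rewrite -[LHS]mulr_natl -[X in _ * X]mulr_natl.
(* With chi(M^+) = 0 the right side is 0 because of the factor chi(M^+) in
   phi^+; the left side is 0 by the support property of chi. *)
have [chi0|chiN0] := eqVneq (chi (increments 1 n Sp)) 0.
  rewrite chi0 mulr0 !mul0r /c (eppf_cat_eq0 H_nonatomic hchi) ?increments_gt0 //.
  by rewrite mul0r !mulr0.
by field.
Qed.

End FixedTheta.

(** The kernel vanishes at u = 0. *)
Lemma expected_likelihood_observed d (Omega : measurableType d) (R : realType)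
    (P : probability Omega R) (G : R.-pker Omega ~> R) (T : seq R) (th : R) :
  th \in T -> expected_likelihood P G T th = 0%E.
Proof.
move=> thT; apply: integral0_eq => w _; rewrite (big_rem th) //=.
rewrite /density integral0_eq ?mul0e // => x _.
by rewrite subrr mix_kernel0.
Qed.

(** * The posterior distribution *)

Lemma expected_likelihood_phi d (Omega : measurableType d) (R : realType)
    (P : probability Omega R) (H : probability R R) (G : R.-pker Omega ~> R)
    (chi : seq nat -> R) (H_nonatomic : forall x : R, H [set x] = 0%E)
    (hchi : is_eppf P H G chi) (N : nat) (T : N.-tuple R) (th : R) :
  expected_likelihood P G T th =
  (\sum_(Sp : svec (n_above th T) | is_spath Sp)
   \sum_(Sm : svec (N - n_above th T) | is_spath Sm)
     phi_prod H chi th T Sm Sp)%:E.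
Proof.
have [thT|thT] := boolP (th \in T).
  rewrite expected_likelihood_observed // big1 // => Sp _.
  by rewrite big1 // => Sm _; rewrite /phi_prod thT.
have := expected_likelihood_spaths H_nonatomic hchi thT.
by rewrite size_tuple.
Qed.

Theorem theorem2p5 (d : measure_display) (Omega : measurableType d)
    (R : realType) (P : probability Omega R)
    (I : countType) (H : probability R R) (W xi : I -> {RV P >-> R})
    (G : R.-pker Omega ~> R) (chi : seq nat -> R)
    (theta : {RV P >-> R}) (prior : probability R R)
    (N : nat) (T : N.-tuple R)
    (hG : species_sampling H W xi G)
    (hchi : is_eppf P H G chi)
    (hprior : forall A : set R, measurable A -> P (theta @^-1` A) = prior A)
    (hindep : independent_of_G theta G)
    (hT : uniq T)
    (hm : (0 < marginal_density G theta T < +oo)%E) :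
  forall B : set R, measurable B ->
    posterior G theta T B =
    (\int[prior]_(th in B)
       \sum_(Sp : svec (n_above th T) | is_spath Sp)
       \sum_(Sm : svec (N - n_above th T) | is_spath Sm)
         post_term H chi prior T th Sm Sp)%E.
Proof.
move=> B mB.
have ELE := expected_likelihood_phi (ss_nonatomic hG) hchi T.
have marginalE : marginal_density G theta T = normalizer H chi prior T.
  rewrite /marginal_density -[X in integral _ X](preimage_setT theta).
  rewrite (integral_likelihood hprior hindep) //.
  by apply: eq_integral => th _; exact: ELE.
rewrite /posterior (integral_likelihood hprior hindep) // marginalE.
move: hm; rewrite marginalE.
case E : (normalizer H chi prior T) => [c| |] //; last by rewrite ltxx andbF.
rewrite lte_fin => /andP[c0 _].
have cE : ((c%:E)^-1 = (c^-1)%:E)%E by rewrite inver gt_eqF.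
rewrite -ge0_integralZr //; last 3 first.
- apply: measurable_funTS.
  exact: (measurable_expected_likelihood hprior hindep).
- by move=> th _; exact: expected_likelihood_ge0.
- by rewrite cE lee_fin invr_ge0 ltW.
apply: eq_integral => th _; rewrite ELE cE -EFinM mulr_suml -sumEFin.
apply: eq_bigr => Sp _; rewrite mulr_suml -sumEFin; apply: eq_bigr => Sm _.
by rewrite /post_term E cE EFinM.
Qed.
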